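(* Let $n$ be a fixed odd number and let $c=\{c_k\}_{k\ge0}$ be a non-decreasing sequence of real numbers with $c_0=1$. Then $$\Delta_{\mathbb{R}^{n+1}}^{\frac{n-1}{2}}\left(\mathcal{HS}(\Omega_c)\right)\subset\mathcal{HM}(\Omega_b),$$ where the sequence $b=\{b_k\}_{k\ge0}$ is given by $$b_k:=\frac{c_{k+n-1}(k!)^2}{[(n+k-1)!]^2},\qquad k\ge0.$$ Moreover, for any $f\in\mathcal{HS}(\Omega_c)$, $$\left\|\Delta_{\mathbb{R}^{n+1}}^{\frac{n-1}{2}}f\right\|^2_{\mathcal{HM}(\Omega_b)}=\gamma_n^2\left(\|f\|^2_{\mathcal{HS}(\Omega_c)}-\sum_{k=0}^{n-2}c_k\frac{|f^{(k)}(0)|^2}{[k!]^2}\right),$$ where $\gamma_n:=\frac{(-1)^{\frac{n-1}{2}}2^{n-1}}{(n-1)!}\left[\Gamma\left(\frac{n+1}{2}\right)\right]^2$.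
   Context: $\mathbb{R}_n$ is the real Clifford algebra generated by $e_1,\dots,e_n$ with $e_\ell e_m+e_me_\ell=0$ for $\ell\ne m$ and $e_\ell^2=-1$; for $a=\sum_A a_Ae_A$, $|a|=(\sum_A a_A^2)^{1/2}$. A point $(x_0,\dots,x_n)\in\mathbb{R}^{n+1}$ is identified with the paravector $x=x_0+\underline{x}$, $\underline{x}=\sum_{\ell=1}^n x_\ell e_\ell$; $\bar x=x_0-\underline{x}$. $\Delta_{\mathbb{R}^{n+1}}=\sum_{i=0}^n\partial_{x_i}^2$. The Clifford-Appell polynomials are $$P_k^n(x):=\sum_{s=0}^k T_s^k(n)\,x^{k-s}\bar x^{s},\qquad T_s^k(n):=\binom{k}{s}\frac{\left(\frac{n+1}{2}\right)_{k-s}\left(\frac{n-1}{2}\right)_s}{(n)_k},$$ where $(a)_0=1$ and $(a)_s=a(a+1)\cdots(a+s-1)$ for $s>0$. For a sequence $d=\{d_k\}_{k\ge0}$ of positive reals put $\Omega_d:=\{x\in\mathbb{R}^{n+1}:\sum_{k\ge0}|x|^{2k}/d_k<\infty\}$. Define $$\mathcal{HS}(\Omega_c):=\Big\{\sum_{k=0}^\infty x^k\beta_k:\ \beta_k\in\mathbb{R}_n,\ \sum_{k=0}^\infty c_k|\beta_k|^2<\infty\Big\},\qquad \mathcal{HM}(\Omega_b):=\Big\{\sum_{k=0}^\infty P_k^n(x)\alpha_k:\ \alpha_k\in\mathbb{R}_n,\ \sum_{k=0}^\infty b_k|\alpha_k|^2<\infty\Big\},$$ as functions on $\Omega_c$,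 respectively $\Omega_b$, with norms $\left\|\sum x^k\beta_k\right\|^2_{\mathcal{HS}(\Omega_c)}=\sum c_k|\beta_k|^2$ and $\left\|\sum P_k^n\alpha_k\right\|^2_{\mathcal{HM}(\Omega_b)}=\sum b_k|\alpha_k|^2$. For $f=\sum x^k\beta_k$, $f^{(k)}(0)$ is the $k$-th derivative at $0$ of the restriction of $f$ to the real line (so $f^{(k)}(0)=k!\beta_k$). The function $\Delta_{\mathbb{R}^{n+1}}^{(n-1)/2}f$ is computed at interior points, and an element of $\mathcal{HM}(\Omega_b)$ is identified with its restriction to the interior of $\Omega_b$. *)

(* Defs.v *)
From HB Require Import structures.
From mathcomp Require Import all_boot all_order all_algebra.
From mathcomp Require Import all_classical all_reals all_analysis.

Set Implicit Arguments.
Unset Strict Implicit.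
Unset Printing Implicit Defensive.

Import Order.TTheory GRing.Theory Num.Theory.
Import numFieldNormedType.Exports.

Local Open Scope classical_set_scope.
Local Open Scope ring_scope.

Section SymmetricDifference.
Context {T : finType}.
Implicit Types A B C : {set T}.

Definition symdiff A B : {set T} := (A :\: B) :|: (B :\: A).

Lemma in_symdiff A B i : (i \in symdiff A B) = (i \in A) (+) (i \in B).
Proof. by rewrite !inE; case: (i \in A); case: (i \in B). Qed.

Lemma symdiffA : associative symdiff.
Proof. by move=> A B C; apply/setP => i; rewrite !in_symdiff addbA. Qed.

Lemma symdiffC : commutative symdiff.
Proof. by move=> A B; apply/setP => i; rewrite !in_symdiff addbC. Qed.

Lemma symdiff0 : right_id finset.set0 symdiff.
Proof. by move=> A; apply/setP => i; rewrite in_symdiff finset.in_set0 addbF. Qed.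

Lemma symdiffv A : symdiff A A = finset.set0.
Proof. by apply/setP => i; rewrite in_symdiff finset.in_set0 addbb. Qed.

Lemma symdiffK A B : symdiff A (symdiff A B) = B.
Proof. by rewrite symdiffA symdiffv symdiffC symdiff0. Qed.

End SymmetricDifference.

(* The Clifford algebra with basis e_A, A a subset of {0, ..., n-1}, where
   e_A is the product of the generators e_l, l in A, in increasing order.
   The type is an alias of {ffun {set 'I_n} -> K}, whose canonical
   multiplication is pointwise and is not the one used here. *)
Definition clifford (K : comNzRingType) (n : nat) : Type :=
  {ffun {set 'I_n} -> K}.

Section CliffordAlgebra.
Context {K : comNzRingType} {n : nat}.
Implicit Types (A B C : {set 'I_n}) (a b : clifford K n).

HB.instance Definition _ :=
  GRing.Zmodule.copy (clifford K n) {ffun {set 'I_n} -> K}.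

Definition cl_scale (k : K) a : clifford K n := [ffun A => k * a A].

Lemma cl_scaleA (k l : K) a : cl_scale k (cl_scale l a) = cl_scale (k * l) a.
Proof. by apply/ffunP => A; rewrite !ffunE mulrA. Qed.

Lemma cl_scale1 : left_id 1 cl_scale.
Proof. by move=> a; apply/ffunP => A; rewrite ffunE mul1r. Qed.

Lemma cl_scaleDr : right_distributive cl_scale +%R.
Proof. by move=> k a b; apply/ffunP => A; rewrite !ffunE mulrDr. Qed.

Lemma cl_scaleDl a : {morph cl_scale^~ a : k l / k + l}.
Proof. by move=> k l; apply/ffunP => A; rewrite !ffunE mulrDl. Qed.

HB.instance Definition _ := GRing.Zmodule_isLmodule.Build K (clifford K n)
  cl_scaleA cl_scale1 cl_scaleDr cl_scaleDl.

(* e_A e_B = (-1)^N e_(A symdiff B), where N = #{(i, j) in A * B | j <= i}: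
   a pair with j < i is a transposition of anticommuting generators, and a
   pair with j = i is a factor e_i ^ 2 = -1. *)
Definition cl_sign A B : bool :=
  odd (\sum_(i in A) \sum_(j in B) (j <= i)%N).

Definition cl_mul a b : clifford K n :=
  [ffun C => \sum_(A : {set 'I_n})
     (-1) ^+ cl_sign A (symdiff A C) * (a A * b (symdiff A C))].

Definition cl_basis A : clifford K n := [ffun C => (C == A)%:R].

Definition cl_one : clifford K n := cl_basis finset.set0.

Definition cl_gen (l : 'I_n) : clifford K n := cl_basis [set l]%SET.

Lemma cl_signE A B : cl_sign A B =
  \big[addb/false]_i \big[addb/false]_j
    [&& i \in A, j \in B & (j <= i)%N].
Proof.
have odd_sum (I : finType) (P : pred I) (F : I -> nat) :
    odd (\sum_(i | P i) F i) = \big[addb/false]_(i | P i) odd (F i).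
  by apply: (big_morph odd oddD).
rewrite /cl_sign odd_sum big_mkcond /=; apply: eq_bigr => i _.
case: (i \in A) => /=; last by rewrite big1.
rewrite odd_sum big_mkcond /=; apply: eq_bigr => j _.
by case: (j \in B) => //=; rewrite oddb.
Qed.

Lemma cl_signDl A B C :
  cl_sign (symdiff A B) C = cl_sign A C (+) cl_sign B C.
Proof.
rewrite !cl_signE -big_split /=; apply: eq_bigr => i _.
rewrite -big_split /=; apply: eq_bigr => j _.
rewrite in_symdiff.
by case: (i \in A); case: (i \in B); case: (j \in C); case: (j <= i)%N.
Qed.

Lemma cl_signDr A B C :
  cl_sign A (symdiff B C) = cl_sign A B (+) cl_sign A C.
Proof.
rewrite !cl_signE -big_split /=; apply: eq_bigr => i _.
rewrite -big_split /=; apply: eq_bigr => j _.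
rewrite in_symdiff.
by case: (i \in A); case: (j \in B); case: (j \in C); case: (j <= i)%N.
Qed.

Lemma cl_sign0l A : cl_sign finset.set0 A = false.
Proof. by rewrite /cl_sign big_set0. Qed.

Lemma cl_sign0r A : cl_sign A finset.set0 = false.
Proof.
by rewrite /cl_sign big1 // => i _; rewrite big_set0.
Qed.

Lemma cl_mulA : associative cl_mul.
Proof.
move=> a b c; apply/ffunP => D; rewrite !ffunE.
under eq_bigr => A _ do rewrite ffunE mulr_sumr mulr_sumr.
under [RHS]eq_bigr => A _ do rewrite ffunE mulr_suml mulr_sumr.
rewrite [RHS]exchange_big /=; apply: eq_bigr => A _.
rewrite [RHS](reindex_inj (can_inj (@symdiffK _ A))) /=.
apply: eq_bigr => B _; rewrite symdiffK.
have -> : symdiff (symdiff A B) D = symdiff B (symdiff A D).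
  by rewrite symdiffA (symdiffC B).
rewrite (mulrCA (a A)) !mulrA -!signr_addb.
congr (_ ^+ nat_of_bool _ * _ * _ * _).
rewrite !cl_signDl !cl_signDr.
by case: (cl_sign A A); case: (cl_sign A B); case: (cl_sign A D);
   case: (cl_sign B A); case: (cl_sign B B); case: (cl_sign B D).
Qed.

Lemma cl_mul1l : left_id cl_one cl_mul.
Proof.
move=> a; apply/ffunP => C; rewrite ffunE (bigD1 finset.set0) //= big1 => [|A nA].
  by rewrite ffunE eqxx cl_sign0l symdiffC symdiff0 expr0 !mul1r addr0.
by rewrite ffunE (negPf nA) mul0r mulr0.
Qed.

Lemma cl_mul1r : right_id cl_one cl_mul.
Proof.
move=> a; apply/ffunP => C; rewrite ffunE (bigD1 C) //= big1 => [|A nA].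
  by rewrite ffunE symdiffv eqxx cl_sign0r expr0 mul1r mulr1 addr0.
rewrite ffunE; case: eqP => [h|_]; last by rewrite !mulr0.
by move: nA; rewrite -(symdiffK A C) h symdiff0 eqxx.
Qed.

Lemma cl_mulDl : left_distributive cl_mul +%R.
Proof.
move=> a b c; apply/ffunP => C; rewrite !ffunE -big_split /=.
by apply: eq_bigr => A _; rewrite ffunE mulrDl mulrDr.
Qed.

Lemma cl_mulDr : right_distributive cl_mul +%R.
Proof.
move=> a b c; apply/ffunP => C; rewrite !ffunE -big_split /=.
by apply: eq_bigr => A _; rewrite ffunE !mulrDr.
Qed.

Lemma cl_one_neq0 : cl_one != 0.
Proof.
apply/eqP => /ffunP/(_ finset.set0); rewrite !ffunE eqxx => /eqP.
by rewrite oner_eq0.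
Qed.

HB.instance Definition _ := GRing.Zmodule_isNzRing.Build (clifford K n)
  cl_mulA cl_mul1l cl_mul1r cl_mulDl cl_mulDr cl_one_neq0.

Lemma cl_scalerAl (k : K) a b : k *: (a * b) = (k *: a) * b.
Proof.
apply/ffunP => C; rewrite !ffunE mulr_sumr; apply: eq_bigr => A _.
by rewrite ffunE -!mulrA [in LHS]mulrCA.
Qed.

HB.instance Definition _ :=
  GRing.Lmodule_isLalgebra.Build K (clifford K n) cl_scalerAl.

Lemma cl_scalerAr (k : K) a b : k *: (a * b) = a * (k *: b).
Proof.
apply/ffunP => C; rewrite !ffunE mulr_sumr; apply: eq_bigr => A _.
by rewrite ffunE [in LHS]mulrCA [in LHS](mulrCA k).
Qed.

HB.instance Definition _ :=
  GRing.Lalgebra_isAlgebra.Build K (clifford K n) cl_scalerAr.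

Lemma cl_basisM A B :
  cl_basis A * cl_basis B = (-1) ^+ cl_sign A B *: cl_basis (symdiff A B).
Proof.
apply/ffunP => C; rewrite !ffunE (bigD1 A) //= big1 => [|A' nA].
  rewrite !ffunE eqxx mul1r addr0.
  have -> : (symdiff A C == B) = (C == symdiff A B).
    by apply/eqP/eqP => [<-|->]; rewrite symdiffK.
  case: eqP => [->|_]; last by rewrite !mulr0.
  by rewrite symdiffK.
by rewrite ffunE (negPf nA) mul0r mulr0.
Qed.

Lemma cl_genM (l m : 'I_n) : cl_gen l * cl_gen m =
  (-1) ^+ (m <= l)%N *: cl_basis (symdiff [set l]%SET [set m]%SET).
Proof. by rewrite cl_basisM /cl_sign !big_set1 oddb. Qed.

Lemma cl_gen_sqr (l : 'I_n) : cl_gen l ^+ 2 = -1.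
Proof. by rewrite expr2 cl_genM leqnn symdiffv scaleN1r. Qed.

Lemma cl_gen_anticomm (l m : 'I_n) :
  l != m -> cl_gen l * cl_gen m + cl_gen m * cl_gen l = 0.
Proof.
move=> nlm; rewrite !cl_genM (symdiffC [set m]%SET) -scalerDl.
have : (l : nat) != m by [].
by case: ltngtP => // _ _; rewrite ?addNr ?subrr scale0r.
Qed.

End CliffordAlgebra.

Section CliffordAppell.
Context {R : realType}.

Definition cl_norm n (a : clifford R n) : R :=
  Num.sqrt (\sum_(A : {set 'I_n}) a A ^+ 2).

Definition enorm n (x : 'rV[R]_n.+1) : R :=
  Num.sqrt (\sum_(i < n.+1) x 0 i ^+ 2).

Definition vec_part n (x : 'rV[R]_n.+1) : clifford R n :=
  \sum_(l < n) x 0 (lift ord0 l) *: cl_gen l.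

Definition paravec n (x : 'rV[R]_n.+1) : clifford R n :=
  (x 0 ord0)%:A + vec_part x.

Definition paravec_conj n (x : 'rV[R]_n.+1) : clifford R n :=
  (x 0 ord0)%:A - vec_part x.

Definition poch (a : R) (s : nat) : R := \prod_(i < s) (a + i%:R).

Definition appell_coef (n k s : nat) : R :=
  'C(k, s)%:R *
  (poch ((n%:R + 1) / 2) (k - s) * poch ((n%:R - 1) / 2) s / poch n%:R k).

Definition appell n (k : nat) (x : 'rV[R]_n.+1) : clifford R n :=
  \sum_(s < k.+1)
    appell_coef n k s *: (paravec x ^+ (k - s) * paravec_conj x ^+ s).

Definition monomial n (k : nat) (x : 'rV[R]_n.+1) : clifford R n :=
  paravec x ^+ k.

Definition Omega n (d : nat -> R) : set 'rV[R]_n.+1 :=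
  [set x | cvgn (series (fun k => enorm x ^+ (2 * k) / d k))].

Definition cl_sums_to n (u : nat -> clifford R n) (a : clifford R n) : Prop :=
  forall A, series (fun k => u k A) @ \oo --> a A.

(* Functions on a subset of R^(n+1) are represented by total functions whose
   values outside of that subset are irrelevant. *)
Definition expansion n (phi : nat -> 'rV[R]_n.+1 -> clifford R n)
    (d : nat -> R) (f : 'rV[R]_n.+1 -> clifford R n)
    (alpha : nat -> clifford R n) : Prop :=
  cvgn (series (fun k => d k * cl_norm (alpha k) ^+ 2)) /\
  forall x, Omega d x -> cl_sums_to (fun k => phi k x * alpha k) (f x).

Definition wspace n (phi : nat -> 'rV[R]_n.+1 -> clifford R n)
    (d : nat -> R) : set ('rV[R]_n.+1 -> clifford R n) :=
  [set f | exists alpha, expansion phi d f alpha].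

(* The coefficients of an expansion in monomials or in Clifford-Appell
   polynomials are unique as soon as Omega d is a neighborhood of 0. *)
Definition wnorm n (phi : nat -> 'rV[R]_n.+1 -> clifford R n)
    (d : nat -> R) (f : 'rV[R]_n.+1 -> clifford R n) : R :=
  let alpha := xget (fun=> 0) [set alpha | expansion phi d f alpha] in
  Num.sqrt (limn (series (fun k => d k * cl_norm (alpha k) ^+ 2))).

Definition HS n := wspace (@monomial n).
Definition HS_norm n := wnorm (@monomial n).
Definition HM n := wspace (@appell n).
Definition HM_norm n := wnorm (@appell n).

Definition cl_comp n (f : 'rV[R]_n.+1 -> clifford R n) (A : {set 'I_n})
    (x : 'rV[R]_n.+1) : R := f x A.

Definition laplacian n (f : 'rV[R]_n.+1 -> clifford R n)
    (x : 'rV[R]_n.+1) : clifford R n :=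
  [ffun A => \sum_(i < n.+1)
     'D_(delta_mx 0 i) ('D_(delta_mx 0 i) (cl_comp f A)) x].

(* 'D_v is total, so that the existence of the second partial derivatives
   has to be recorded separately. *)
Definition laplacian_exists n (f : 'rV[R]_n.+1 -> clifford R n)
    (x : 'rV[R]_n.+1) : Prop :=
  forall (A : {set 'I_n}) (i : 'I_n.+1),
    (\forall y \near x, derivable (cl_comp f A) y (delta_mx 0 i)) /\
    derivable ('D_(delta_mx 0 i) (cl_comp f A)) x (delta_mx 0 i).

Definition iter_laplacian n (m : nat) (f : 'rV[R]_n.+1 -> clifford R n) :=
  iter m (@laplacian n) f.

Definition iter_laplacian_exists n (m : nat) (U : set 'rV[R]_n.+1)
    (f : 'rV[R]_n.+1 -> clifford R n) : Prop :=
  forall j, (j < m)%N ->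
    forall x, U x -> laplacian_exists (iter_laplacian j f) x.

Definition eq_on n (U : set 'rV[R]_n.+1)
    (f g : 'rV[R]_n.+1 -> clifford R n) : Prop :=
  forall x, U x -> f x = g x.

(* Elements of HM, identified with their restrictions to the interior of the
   domain. *)
Definition HM_interior n (d : nat -> R) :
    set ('rV[R]_n.+1 -> clifford R n) :=
  [set g | exists2 h, HM d h & eq_on (Omega d)° g h].

Definition real_derivn0 n (k : nat) (f : 'rV[R]_n.+1 -> clifford R n) :
    clifford R n :=
  [ffun A => derive1n k (fun t : R => f (t *: delta_mx 0 ord0) A) 0].

Definition Gamma (z : R) : R :=
  Rintegral lebesgue_measure `]0, +oo[%classic
    (fun t : R => t `^ (z - 1) * expR (- t)).

Definition sce_const (n : nat) : R :=
  (-1) ^+ n.-1./2 * 2 ^+ n.-1 / n.-1`!%:R * Gamma ((n%:R + 1) / 2) ^+ 2.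

Definition sce_weight (n : nat) (c : nat -> R) (k : nat) : R :=
  c (k + n).-1 * k`!%:R ^+ 2 / (n + k).-1`!%:R ^+ 2.

End CliffordAppell.

Arguments Omega {R} n d _.
Arguments HS {R} n d _.
Arguments HS_norm {R} n d f.
Arguments HM {R} n d _.
Arguments HM_norm {R} n d f.
Arguments HM_interior {R} n d _.
Arguments appell_coef {R} n k s.
Arguments sce_const {R} n.

(* Main.v *)
(* Write x = x0 + v. On the products x0 ^ a v ^ j the Laplacian acts by an explicit
   two-term formula, so that with m = (n - 1) / 2 the m-th iterated Laplacian of
   x ^ k / k! is a sum of x0 ^ a / a! * v ^ j / j! with coefficients known in closed
   form. The polynomials P_k form an Appell sequence in x0, hence are determined by
   their values at x0 = 0; there they satisfy the same two-term recursion as the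
   coefficients above. This gives
     Laplacian ^ m (x ^ k) = gamma_n k! / (k - n + 1)! P_(k - n + 1)(x)
   (0 when k < n - 1), and the weights b_k turn this into the norm identity.

   The Laplacian may be applied termwise because multiplication by a paravector
   multiplies the Clifford norm: all the derivatives of x ^ k are sums of words in
   x and the units, of norm at most a power of k times a power of |x|. Coefficients
   of an expansion are recovered from derivatives at 0 along the real axis, where
   both x ^ k and P_k(x) reduce to t ^ k. *)

Require Import Defs.
From mathcomp Require Import all_boot all_order all_algebra.
From mathcomp Require Import all_classical all_reals all_analysis.
From mathcomp Require Import measurable_realfun ring lra.

Set Implicit Arguments.
Unset Strict Implicit.
Unset Printing Implicit Defensive.

Import Order.TTheory GRing.Theory Num.Theory.
Import numFieldNormedType.Exports.

Local Open Scope classical_set_scope.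
Local Open Scope ring_scope.

(** * The Clifford norm *)

Section CliffordNorm.
Context {R : realType} {n : nat}.
Implicit Types (a b : clifford R n) (x : 'rV[R]_n.+1).

(** [Omega c] and [Omega b] may differ on their boundary spheres, where termwise differentiation
    says nothing. Their interiors agree, because b_k is c_(k+n-1) divided by the square of a
    polynomial in k, which does not change the radius of convergence. The analysis therefore runs
    over radii strictly below some radius of convergence; this slack absorbs each factor k that a
    derivative produces. The norms of [HS] and [HM] are computed from coefficients picked by choice,
    so the norm identity presupposes their uniqueness, also for a function known only through its
    values on the interior. Monotonicity and c_0 = 1 give c_k >= 1, which puts the open unit ball,
    hence the real interval ]-1, 1[, into the interior, and that is enough to read the coefficients
    off. *)

Definition cl_dot a b : R := \sum_A a A * b A.

Lemma cl_dotC a b : cl_dot a b = cl_dot b a.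
Proof. by apply: eq_bigr => A _; rewrite mulrC. Qed.

Lemma cl_dotDl a b c : cl_dot (a + b) c = cl_dot a c + cl_dot b c.
Proof. by rewrite /cl_dot -big_split; apply: eq_bigr => A _; rewrite ffunE mulrDl. Qed.

Lemma cl_dotZl k a b : cl_dot (k *: a) b = k * cl_dot a b.
Proof.
by rewrite /cl_dot mulr_sumr; apply: eq_bigr => A _; rewrite ffunE mulrA.
Qed.

Lemma cl_dotDr a b c : cl_dot a (b + c) = cl_dot a b + cl_dot a c.
Proof. by rewrite cl_dotC cl_dotDl !(cl_dotC a). Qed.

Lemma cl_dotZr k a b : cl_dot a (k *: b) = k * cl_dot a b.
Proof. by rewrite cl_dotC cl_dotZl cl_dotC. Qed.

Lemma cl_dotNr a b : cl_dot a (- b) = - cl_dot a b.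
Proof. by rewrite -scaleN1r cl_dotZr mulN1r. Qed.

Lemma cl_dotNl a b : cl_dot (- a) b = - cl_dot a b.
Proof. by rewrite cl_dotC cl_dotNr cl_dotC. Qed.

Lemma cl_dot0l b : cl_dot 0 b = 0.
Proof. by rewrite -(scale0r 0) cl_dotZl mul0r. Qed.

Lemma cl_dot0r b : cl_dot b 0 = 0.
Proof. by rewrite cl_dotC cl_dot0l. Qed.

Lemma cl_dot_ge0 a : 0 <= cl_dot a a.
Proof. by apply: sumr_ge0 => A _; rewrite -expr2 sqr_ge0. Qed.

Lemma cl_norm_ge0 a : 0 <= cl_norm a.
Proof. exact: sqrtr_ge0. Qed.

Lemma cl_normE a : cl_norm a = Num.sqrt (cl_dot a a).
Proof. by []. Qed.

Lemma cl_norm_sqr a : cl_norm a ^+ 2 = cl_dot a a.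
Proof. by rewrite cl_normE sqr_sqrtr ?cl_dot_ge0. Qed.

Lemma cl_norm_comp a A : `|a A| <= cl_norm a.
Proof.
rewrite -sqrtr_sqr ler_sqrt; last exact: cl_dot_ge0.
by rewrite (bigD1 A) //= lerDl sumr_ge0 // => B _; rewrite sqr_ge0.
Qed.

Lemma cl_norm_eq0 a : cl_norm a = 0 -> a = 0.
Proof.
move=> a0; apply/ffunP => A; rewrite ffunE; apply/eqP.
by rewrite -normr_le0 -a0 cl_norm_comp.
Qed.

Lemma cl_norm0 : cl_norm (0 : clifford R n) = 0.
Proof. by rewrite cl_normE cl_dot0l sqrtr0. Qed.

Lemma cl_normZ k a : cl_norm (k *: a) = `|k| * cl_norm a.
Proof.
by rewrite !cl_normE cl_dotZl cl_dotZr mulrA -expr2 sqrtrM ?sqr_ge0 // sqrtr_sqr.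
Qed.

Lemma cl_cauchy_schwarz a b : cl_dot a b <= cl_norm a * cl_norm b.
Proof.
have [a0|a0] := eqVneq (cl_norm a) 0.
  by rewrite a0 (cl_norm_eq0 a0) cl_dot0l mul0r.
have [b0|b0] := eqVneq (cl_norm b) 0.
  by rewrite b0 (cl_norm_eq0 b0) cl_dot0r mulr0.
have ab_gt0 : 0 < cl_norm a * cl_norm b.
  by rewrite mulr_gt0 // lt_neqAle eq_sym cl_norm_ge0 ?a0 ?b0.
have := cl_dot_ge0 (cl_norm b *: a - cl_norm a *: b).
rewrite cl_dotDl !cl_dotDr !cl_dotNl !cl_dotNr !cl_dotZl !cl_dotZr.
rewrite -!cl_norm_sqr (cl_dotC b a) => h.
rewrite -(ler_pM2l ab_gt0); lra.
Qed.

Lemma cl_normD a b : cl_norm (a + b) <= cl_norm a + cl_norm b.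
Proof.
rewrite -(@ler_pXn2r _ 2) ?nnegrE ?addr_ge0 ?cl_norm_ge0 //.
rewrite cl_norm_sqr cl_dotDl !cl_dotDr sqrrD -!cl_norm_sqr (cl_dotC b a).
have := cl_cauchy_schwarz a b; lra.
Qed.

Lemma cl_norm_sum (I : Type) (r : seq I) (P : pred I) (F : I -> clifford R n) :
  cl_norm (\sum_(i <- r | P i) F i) <= \sum_(i <- r | P i) cl_norm (F i).
Proof.
elim/big_rec2: _ => [|i y z _ h]; first by rewrite cl_norm0.
by rewrite (le_trans (cl_normD _ _)) // lerD2l.
Qed.

Lemma cl_genMl_comp (l : 'I_n) a (C : {set 'I_n}) :
  (cl_gen l * a) C =
  (-1) ^+ cl_sign [set l]%SET (symdiff [set l]%SET C) * a (symdiff [set l]%SET C).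
Proof.
rewrite ffunE (bigD1 [set l]%SET) //= big1 => [|A nA].
  by rewrite ffunE eqxx mul1r addr0.
by rewrite ffunE (negPf nA) mul0r mulr0.
Qed.

(** Left multiplication by e_l permutes the basis up to signs and has square -1, hence it is skew:
    after reindexing by [symdiff [set l]] the two signs differ by that of e_l e_l. *)
Lemma cl_dot_genMl (l : 'I_n) a b :
  cl_dot (cl_gen l * a) b = - cl_dot a (cl_gen l * b).
Proof.
rewrite /cl_dot -sumrN.
rewrite (reindex_inj (can_inj (@symdiffK _ [set l]%SET))) /=.
apply: eq_bigr => C _; rewrite !cl_genMl_comp symdiffK cl_signDr.
rewrite {2}/cl_sign !big_set1 leqnn /=.
by case: (cl_sign _ C) => /=; ring.
Qed.

Definition vec_sqr x : R := \sum_(l < n) x 0 (lift ord0 l) ^+ 2.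

(** The double sum is added to its transpose, so that anticommutation cancels everything off the
    diagonal. *)
Lemma vec_part_sqr x : vec_part x ^+ 2 = - (vec_sqr x)%:A.
Proof.
pose F (l m : 'I_n) := x 0 (lift ord0 l) * x 0 (lift ord0 m).
have sqrE : vec_part x ^+ 2 =
    \sum_l \sum_m F l m *: (cl_gen l * cl_gen m).
  rewrite expr2 /vec_part mulr_suml; apply: eq_bigr => l _.
  rewrite mulr_sumr; apply: eq_bigr => m _.
  by rewrite -cl_scalerAl -cl_scalerAr scalerA.
have sqrE' : vec_part x ^+ 2 =
    \sum_l \sum_m F l m *: (cl_gen m * cl_gen l).
  rewrite sqrE exchange_big; apply: eq_bigr => l _; apply: eq_bigr => m _.
  by rewrite /F mulrC.
apply: (@scalerI _ _ 2); first by rewrite pnatr_eq0.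
rewrite scaler_nat mulr2n {1}sqrE sqrE' -big_split /=.
rewrite /vec_sqr scaler_suml -sumrN scaler_sumr; apply: eq_bigr => l _.
rewrite -big_split (bigD1 l) //= big1 ?addr0 => [|m lm].
  by rewrite -mulr2n -scaler_nat /F -expr2 -expr2 cl_gen_sqr scalerN.
by rewrite -scalerDr cl_gen_anticomm ?scaler0 // eq_sym.
Qed.

Lemma enorm_ge0 x : 0 <= enorm x.
Proof. exact: sqrtr_ge0. Qed.

Lemma enorm_sqr x : enorm x ^+ 2 = x 0 ord0 ^+ 2 + vec_sqr x.
Proof.
by rewrite /enorm sqr_sqrtr ?sumr_ge0 // => [|i _]; rewrite ?sqr_ge0 // big_ord_recl.
Qed.

Lemma paravec_conjM x : paravec_conj x * paravec x = (enorm x ^+ 2)%:A.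
Proof.
rewrite enorm_sqr /paravec /paravec_conj mulrDr !mulrBl.
rewrite -[vec_part x * vec_part x]expr2 vec_part_sqr opprK scalerDl !mulr_algl mulr_algr.
by rewrite scalerA -expr2 addrA subrK.
Qed.

Lemma cl_dot_vec_partMl x a b :
  cl_dot (vec_part x * a) b = - cl_dot a (vec_part x * b).
Proof.
rewrite /vec_part !mulr_suml.
elim/big_rec2: _ => [|l u v _ IH]; first by rewrite cl_dot0l cl_dot0r oppr0.
rewrite cl_dotDl cl_dotDr IH -!cl_scalerAl cl_dotZl cl_dotZr cl_dot_genMl.
by rewrite mulrN opprD.
Qed.

(** Since the vector part acts skewly, multiplication by [paravec_conj x] is the adjoint of
    multiplication by [paravec x], and their composite is the scalar |x|^2. *)
Lemma cl_norm_paravecMl x a : cl_norm (paravec x * a) = enorm x * cl_norm a.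
Proof.
rewrite !cl_normE.
have -> : cl_dot (paravec x * a) (paravec x * a) = enorm x ^+ 2 * cl_dot a a.
  transitivity (cl_dot a (paravec_conj x * paravec x * a)).
    rewrite -mulrA; set p := paravec x * a; rewrite {1}/p /paravec /paravec_conj.
    rewrite mulrBl mulrDl cl_dotDl cl_dotDr cl_dotNr !mulr_algl cl_dotZl cl_dotZr.
    by rewrite cl_dot_vec_partMl.
  by rewrite paravec_conjM mulr_algl cl_dotZr.
by rewrite sqrtrM ?sqr_ge0 // sqrtr_sqr ger0_norm ?enorm_ge0.
Qed.

Lemma vec_partN x : vec_part (- x) = - vec_part x.
Proof.
by rewrite /vec_part -sumrN; apply: eq_bigr => l _; rewrite mxE scaleNr.
Qed.

Lemma cl_norm_paravec_conjMl x a :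
  cl_norm (paravec_conj x * a) = enorm x * cl_norm a.
Proof.
pose y : 'rV[R]_n.+1 := \row_i (if i == ord0 then x 0 i else - x 0 i).
have -> : paravec_conj x = paravec y.
  rewrite /paravec_conj /paravec mxE eqxx; congr (_ + _).
  by rewrite -vec_partN; apply: eq_bigr => l _; rewrite !mxE.
rewrite cl_norm_paravecMl; congr (_ * _); rewrite /enorm; congr Num.sqrt.
by apply: eq_bigr => i _; rewrite mxE; case: ifP => // _; rewrite sqrrN.
Qed.

Lemma cl_norm_paravecXMl k x a :
  cl_norm (paravec x ^+ k * a) = enorm x ^+ k * cl_norm a.
Proof.
elim: k => [|k IH]; first by rewrite !expr0 !mul1r.
by rewrite !exprS -!mulrA cl_norm_paravecMl IH.
Qed.

Lemma cl_norm_paravec_conjXMl k x a :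
  cl_norm (paravec_conj x ^+ k * a) = enorm x ^+ k * cl_norm a.
Proof.
elim: k => [|k IH]; first by rewrite !expr0 !mul1r.
by rewrite !exprS -!mulrA cl_norm_paravec_conjMl IH.
Qed.

End CliffordNorm.

(** * Partial derivatives *)

Section PartialDerivatives.
Context {R : realType} {n : nat}.
Notation point := 'rV[R]_n.+1.
Implicit Types (u w : point -> clifford R n) (x : point) (i : 'I_n.+1).

(** A relation rather than a function: ['D_v] is total, and here existence of the derivative travels
    with its value. *)
Definition is_pd i u (du : point -> clifford R n) : Prop :=
  forall x A, is_derive x (delta_mx 0 i) (cl_comp u A) (du x A).

Definition pd i u : point -> clifford R n :=
  fun x => [ffun A => 'D_(delta_mx 0 i) (cl_comp u A) x].

Lemma is_pd_pd i u du : is_pd i u du -> pd i u = du.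
Proof.
move=> h; apply/funext => x; apply/ffunP => A.
by rewrite ffunE; have := h x A => ?; rewrite derive_val.
Qed.

Lemma cl_comp_pd i u A : cl_comp (pd i u) A = 'D_(delta_mx 0 i) (cl_comp u A).
Proof. by apply/funext => x; rewrite /cl_comp ffunE. Qed.

Lemma laplacianE u x : laplacian u x = \sum_i pd i (pd i u) x.
Proof.
apply/ffunP => A; rewrite sum_ffunE ffunE; apply: eq_bigr => i _.
by rewrite [RHS]ffunE cl_comp_pd.
Qed.

Lemma is_derive_ext (V : normedModType R) (f g : V -> R) (x v : V) (d e : R) :
  is_derive x v f d -> f =1 g -> d = e -> is_derive x v g e.
Proof. by move=> h /funext <- <-. Qed.

Lemma is_derive_bigsum (V : normedModType R) (I : Type) (r : seq I) (P : pred I)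
    (h : I -> V -> R) (dh : I -> R) (x v : V) :
  (forall k, is_derive x v (h k) (dh k)) ->
  is_derive x v (fun y => \sum_(k <- r | P k) h k y) (\sum_(k <- r | P k) dh k).
Proof.
move=> hdh; have -> : (fun y => \sum_(k <- r | P k) h k y) =
    \sum_(k <- r | P k) h k by apply/funext => y; rewrite fct_sumE.
elim/big_ind2 : _ => // [|? ? ? ? ? ?]; first exact: is_derive_cst.
exact: is_deriveD.
Qed.

Lemma is_derive_coord x (v : point) (j : 'I_n.+1) :
  is_derive x v (fun y : point => y 0 j) (v 0 j).
Proof.
have H : (fun h : R => h^-1 *: ((h *: v + x) 0 j - x 0 j)) @ 0^' --> v 0 j.
  apply: (@cvg_trans _ (cst (v 0 j) @ (0 : R)^')); last exact: cvg_cst.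
  apply: near_eq_cvg; near=> h => /=.
  rewrite !mxE addrK /= [_ *: _]mulrA mulVf ?mul1r //.
  by near: h; exact: nbhs_dnbhs_neq.
split; first exact: (cvgP (v 0 j) H).
exact: (cvg_lim _ H).
Unshelve. all: by end_near. Qed.

Lemma is_pd_cst i a : is_pd i (fun=> a) (fun=> 0).
Proof. by move=> x A; rewrite ffunE; exact: is_derive_cst. Qed.

Lemma is_pdD i u w du dw :
  is_pd i u du -> is_pd i w dw -> is_pd i (fun x => u x + w x) (fun x => du x + dw x).
Proof.
move=> hu hw x A; apply: (is_derive_ext (is_deriveD (hu x A) (hw x A))) => [y|].
  by rewrite /cl_comp ffunE.
by rewrite ffunE.
Qed.

Lemma is_pd_sum (I : Type) (r : seq I) (P : pred I) i
    (u du : I -> point -> clifford R n) : (forall j, is_pd i (u j) (du j)) ->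
  is_pd i (fun x => \sum_(j <- r | P j) u j x)
    (fun x => \sum_(j <- r | P j) du j x).
Proof.
move=> h x A.
apply: (is_derive_ext (@is_derive_bigsum _ _ r P _ _ _ _ (fun j => h j x A))) => [y|].
  by rewrite /cl_comp sum_ffunE.
by rewrite sum_ffunE.
Qed.

Lemma is_pdM i u w du dw : is_pd i u du -> is_pd i w dw ->
  is_pd i (fun x => u x * w x) (fun x => du x * w x + u x * dw x).
Proof.
move=> hu hw x C.
pose h A : point -> R := ((-1) ^+ cl_sign A (symdiff A C)) \*:
  (cl_comp u A * cl_comp w (symdiff A C)).
have dh A : is_derive x (delta_mx 0 i) (h A)
  ((-1) ^+ cl_sign A (symdiff A C) * (du x A * w x (symdiff A C)) +
   (-1) ^+ cl_sign A (symdiff A C) * (u x A * dw x (symdiff A C))).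
  apply: (is_derive_ext (is_deriveZ ((-1) ^+ cl_sign A (symdiff A C))
    (is_deriveM (hu x A) (hw x (symdiff A C))))) => //.
  by rewrite scalerDr addrC (mulrC (du x A)).
apply: (is_derive_ext (@is_derive_bigsum _ _ (index_enum _) xpredT _ _ _ _ dh)).
  by move=> y; rewrite /cl_comp ffunE.
by rewrite big_split !ffunE.
Qed.

Lemma is_pd_coordZ i (j : 'I_n.+1) a :
  is_pd i (fun x => x 0 j *: a) (fun=> (j == i)%:R *: a).
Proof.
move=> x A.
apply: (is_derive_ext (is_deriveZ (a A) (is_derive_coord x (delta_mx 0 i) j))).
  by move=> y; rewrite /cl_comp ffunE mulrC.
by rewrite ffunE mxE /= mulrC.
Qed.

Lemma is_pd_paravec i : is_pd i (@paravec R n) (fun=> paravec (delta_mx 0 i)).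
Proof.
move=> x A.
apply: (is_derive_ext (is_pdD (is_pd_coordZ i ord0 1)
  (is_pd_sum (index_enum _) xpredT
     (fun l : 'I_n => is_pd_coordZ i (lift ord0 l) (cl_gen l))) x A)) => //.
congr (fun_of_fin _ A); rewrite /paravec mxE /=; congr (_ + _).
by apply: eq_bigr => l _; rewrite mxE.
Qed.

End PartialDerivatives.

(** * Termwise differentiation *)

Section TermwiseDifferentiation.
Context {R : realType}.

Lemma cvgn_norm_le (u : nat -> R) (l B : R) :
  u @ \oo --> l -> (forall N, `|u N| <= B) -> `|l| <= B.
Proof.
move=> ul uB; have ul' : (fun k => `|u k|) @ \oo --> `|l| by exact: cvg_norm ul.
rewrite -(cvg_lim _ ul') //; apply: limr_le; first exact: cvgP ul'.
by apply: nearW.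
Qed.

Lemma series_le_lim (u : nat -> R) N :
  (forall k, 0 <= u k) -> cvgn (series u) -> series u N <= limn (series u).
Proof.
move=> u0 cu; apply: nondecreasing_cvgn_le => //.
by apply: nondecreasing_series.
Qed.

Lemma mvt_centered (g dg : R -> R) (delta h : R) : `|h| < delta ->
  (forall t : R, `|t| < delta -> is_derive t 1 g (dg t)) ->
  exists2 c, `|c| <= `|h| & g h - g 0 = dg c * h.
Proof.
move=> hd dgP.
have cont t : `|t| < delta -> {for t, continuous g}.
  move=> /dgP[dgt _]; exact/differentiable_continuous/derivable1_diffP.
have [h0|h0] := leP 0 h.
  have [||c] := @MVT_segment R g dg 0 h h0.
  - move=> t; rewrite in_itv /= => /andP[t0 th]; apply: dgP.
    by rewrite gtr0_norm // (lt_trans th) // (le_lt_trans (ler_norm h)).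
  - apply: continuous_in_subspaceT => t; rewrite inE /= in_itv /= => /andP[t0 th].
    by apply: cont; rewrite ger0_norm // (le_lt_trans th) // (le_lt_trans (ler_norm h)).
  - rewrite in_itv /= => /andP[c0 ch] E; exists c; last by rewrite E subr0.
    by rewrite !ger0_norm.
have nh : `|h| = - h by rewrite ltr0_norm.
have [||c] := @MVT_segment R g dg h 0 (ltW h0).
- move=> t; rewrite in_itv /= => /andP[t0 th]; apply: dgP.
  by rewrite ltr0_norm // (le_lt_trans _ hd) // nh lerN2 ltW.
- apply: continuous_in_subspaceT => t; rewrite inE /= in_itv /= => /andP[t0 th].
  by apply: cont; rewrite ler0_norm // (le_lt_trans _ hd) // nh lerN2.
- rewrite in_itv /= => /andP[c0 ch] E; exists c.
    by rewrite nh ler0_norm // lerN2.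
  by rewrite -opprB E sub0r mulrN opprK.
Qed.

(** Taylor's estimate by two uses of the mean value theorem, which lose the factor 1/2. *)
Lemma second_order_bound (g dg ddg : R -> R) (delta M h : R) :
  (forall t : R, `|t| < delta -> is_derive t 1 g (dg t)) ->
  (forall t : R, `|t| < delta -> is_derive t 1 dg (ddg t)) ->
  (forall t, `|t| < delta -> `|ddg t| <= M) ->
  `|h| < delta -> `|g h - g 0 - h * dg 0| <= h ^+ 2 * M.
Proof.
move=> dgP ddgP ddgM hd.
have [c ch ->] := mvt_centered hd dgP.
have cd := le_lt_trans ch hd.
have [c' c'c E] := mvt_centered cd ddgP.
have -> : dg c * h - h * dg 0 = (dg c - dg 0) * h by ring.
rewrite E !normrM -mulrA mulrC ler_pM ?mulr_ge0 //.
  by rewrite -(real_normK (num_real h)) expr2 ler_wpM2r.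
by rewrite ddgM // (le_lt_trans c'c).
Qed.

(** The second order bounds add up to |G h - G 0 - h L| <= h^2 S. Pointwise limits thus suffice for
    the series and for its derivative at 0, at the price of a majorant for the second
    derivatives. *)
Lemma is_derive_series (g dg ddg : nat -> R -> R) (M : nat -> R) (delta L : R)
    (G : R -> R) : 0 < delta -> cvgn (series M) ->
  (forall k (t : R), `|t| < delta -> is_derive t 1 (g k) (dg k t)) ->
  (forall k (t : R), `|t| < delta -> is_derive t 1 (dg k) (ddg k t)) ->
  (forall k t, `|t| < delta -> `|ddg k t| <= M k) ->
  (forall t, `|t| < delta -> series (g^~ t) @ \oo --> G t) ->
  series (dg^~ 0) @ \oo --> L ->
  is_derive (0 : R) 1 G L.
Proof.
move=> delta0 cM dgP ddgP ddgM gG dgL.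
have M0 k : 0 <= M k by rewrite (le_trans _ (ddgM k 0 _)) ?normr0.
set S := limn (series M).
have S0 : 0 <= S by apply: le_trans (series_le_lim 0 M0 cM); rewrite /series /= big_nil.
have bound h : `|h| < delta -> `|G h - G 0 - h * L| <= h ^+ 2 * S.
  move=> hd; pose v k := g k h - g k 0 - h * dg k 0.
  have vE : series v = (fun N =>
      series (g^~ h) N - series (g^~ 0) N - h * series (dg^~ 0) N).
    apply/funext => N; rewrite /series /= mulr_sumr -!sumrB.
    by apply: eq_bigr.
  have vl : series v @ \oo --> G h - G 0 - h * L.
    rewrite vE; apply: cvgB; first by apply: cvgB; apply: gG; rewrite ?normr0.
    exact: cvgMr.
  apply: (cvgn_norm_le vl) => N.
  apply: (@le_trans _ _ (\sum_(0 <= k < N) h ^+ 2 * M k)).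
    rewrite (le_trans (ler_norm_sum _ _ _)) //; apply: ler_sum => k _.
    exact: (second_order_bound (dgP k) (ddgP k) (ddgM k)).
  by rewrite -mulr_sumr ler_wpM2l ?sqr_ge0 // (series_le_lim N M0 cM).
have H : (fun h => h^-1 *: (G (h *: 1 + 0) - G 0)) @ (0 : R)^' --> L.
  apply/cvgrPdist_le => e e0; near=> h.
  have h0 : h != 0 by near: h; exact: nbhs_dnbhs_neq.
  have hd : `|h| < delta.
    by near: h; apply: dnbhs0_lt.
  (* S may be 0, hence the denominator S + 1. *)
  have he : `|h| <= e / (S + 1).
    by near: h; apply: dnbhs0_le; rewrite divr_gt0 // ltr_wpDl.
  rewrite addr0 [h *: 1]mulr1.
  have -> : L - h^-1 *: (G h - G 0) = - (h^-1 * (G h - G 0 - h * L)).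
    rewrite [X in L - X](_ : _ = h^-1 * (G h - G 0)) //.
    by rewrite [in RHS]mulrBr mulKf // opprB.
  rewrite normrN normrM normfV ler_pdivrMl ?normr_gt0 //.
  rewrite (le_trans (bound h hd)) // -(real_normK (num_real h)) expr2 -mulrA.
  rewrite ler_wpM2l // (le_trans (ler_wpM2r S0 he)) // -mulrA ler_piMr ?(ltW e0) //.
  by rewrite ler_pdivrMl ?mulr1 ?lerDl // ltr_wpDl.
split; first exact: (cvgP L H).
exact: (cvg_lim _ H).
Unshelve. all: by end_near. Qed.

(** Both sides have the same difference quotient; this carries one-variable results over to partial
    derivatives. *)
Lemma is_derive_line (V : normedModType R) (f : V -> R) (x v : V) (t d : R) :
  is_derive t (1 : R) (fun s => f (s *: v + x)) d <->
  is_derive (t *: v + x) v f d.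
Proof.
have E : (fun h : R => h^-1 *: (f ((h *: (1 : R) + t) *: v + x) - f (t *: v + x)))
   = (fun h : R => h^-1 *: (f (h *: v + (t *: v + x)) - f (t *: v + x))).
  apply/funext => h; congr (_ *: (f _ - _)).
  by rewrite [h *: 1]mulr1 scalerDl addrA.
by split => -[]; rewrite /derivable /derive ?E => ? ?; split;
  rewrite /derivable /derive ?E.
Qed.

End TermwiseDifferentiation.

(** * Growth of words in a paravector and of their derivatives *)

Section Growth.
Context {R : realType} {n : nat}.
Notation point := 'rV[R]_n.+1.
Implicit Types (u : point -> clifford R n) (x : point) (a : clifford R n).

(* Sums of words in the variable x and the units e_i, each containing x exactly
   d times; C is the sum of the norms of the constant factors. Multiplication
   by a paravector multiplies norms, hence the sharp bound C |x|^d, and partial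
   differentiation costs exactly a factor d. *)
Inductive growth : nat -> R -> (point -> clifford R n) -> Prop :=
| growth0 d : growth d 0 (fun=> 0)
| growth_cst a : growth 0 (cl_norm a) (fun=> a)
| growth_paravecMl d C u :
    growth d C u -> growth d.+1 C (fun x => paravec x * u x)
| growth_unitMl d C u i :
    growth d C u -> growth d C (fun x => paravec (delta_mx 0 i) * u x)
| growthD d C1 C2 u1 u2 : growth d C1 u1 -> growth d C2 u2 ->
    growth d (C1 + C2) (fun x => u1 x + u2 x).

Lemma growth_ge0 d C u : growth d C u -> 0 <= C.
Proof. by elim=> // *; rewrite ?cl_norm_ge0 ?addr_ge0. Qed.

Lemma enorm_delta i : enorm (delta_mx 0 i : point) = 1.
Proof.
rewrite /enorm (bigD1 i) //= big1 ?addr0 => [|j ji].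
  by rewrite mxE !eqxx expr1n sqrtr1.
by rewrite mxE (negPf ji) andbF expr0n.
Qed.

Lemma growth_bound d C u x : growth d C u -> cl_norm (u x) <= C * enorm x ^+ d.
Proof.
elim=> {d C u} [d|a|d C u _ IH|d C u i _ IH|d C1 C2 u1 u2 _ IH1 _ IH2].
- by rewrite cl_norm0 mul0r.
- by rewrite expr0 mulr1.
- by rewrite cl_norm_paravecMl exprS mulrCA ler_wpM2l ?enorm_ge0.
- by rewrite cl_norm_paravecMl enorm_delta mul1r.
- by rewrite mulrDl (le_trans (cl_normD _ _)) // lerD.
Qed.

(** The last clause serves the induction: in the derivative e_i u + x du of x u, the second term has
    degree d.-1.+1, which is d only for d > 0. *)
Lemma growth_is_pd i d C u : growth d C u ->
  exists du, [/\ is_pd i u du, growth d.-1 (d%:R * C) du & d = 0%N -> du = fun=> 0].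
Proof.
elim=> {d C u} [d|a|d C u + [du [hdu gdu du0]]|d C u j _ [du [hdu gdu du0]]|].
- exists (fun=> 0); split=> //; first exact: is_pd_cst.
  by rewrite mulr0; exact: growth0.
- exists (fun=> 0); split=> //; first exact: is_pd_cst.
  by rewrite mul0r; exact: growth0.
- move=> gu.
  exists (fun x => paravec (delta_mx 0 i) * u x + paravec x * du x); split=> //.
    exact: (is_pdM (is_pd_paravec i) hdu).
  rewrite -[d.+1]add1n natrD mulrDl mul1r /=; apply: growthD.
    exact: growth_unitMl.
  case: d {gu} gdu du0 => [_ ->//|d gdu _]; last exact: growth_paravecMl.
  have -> : (fun x : point => paravec x * 0 : clifford R n) = fun=> 0.
    by apply/funext => x; rewrite mulr0.
  by rewrite mul0r; exact: growth0.
- exists (fun x => paravec (delta_mx 0 j) * du x); split.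
  + have := is_pdM (is_pd_cst i (paravec (delta_mx 0 j))) hdu.
    by congr is_pd; apply/funext => x; rewrite mul0r add0r.
  + exact: growth_unitMl.
  + by move=> /du0 ->; apply/funext => x; rewrite mulr0.
- move=> d C1 C2 u1 u2 _ [du1 [h1 g1 z1]] _ [du2 [h2 g2 z2]].
  exists (fun x => du1 x + du2 x); split; first exact: is_pdD.
    by rewrite mulrDr; exact: growthD.
  by move=> d0; rewrite z1 // z2 //; apply/funext => x; rewrite addr0.
Qed.

End Growth.

Section EuclideanNorm.
Context {R : realType} {n : nat}.
Implicit Types (x y : 'rV[R]_n.+1).

Lemma paravecD x y : paravec (x + y) = paravec x + paravec y.
Proof.
rewrite /paravec mxE scalerDl addrACA; congr (_ + _).
by rewrite -big_split; apply: eq_bigr => l _; rewrite mxE scalerDl.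
Qed.

Lemma paravecZ k x : paravec (k *: x) = k *: paravec x.
Proof.
rewrite /paravec mxE scalerDr scalerA; congr (_ + _).
by rewrite scaler_sumr; apply: eq_bigr => l _; rewrite mxE scalerA.
Qed.

Lemma cl_norm1 : cl_norm (1 : clifford R n) = 1.
Proof.
rewrite /cl_norm (bigD1 finset.set0) //= big1 ?addr0 => [|A A0].
  by rewrite ffunE eqxx expr1n sqrtr1.
by rewrite ffunE (negPf A0) expr0n.
Qed.

Lemma cl_norm_paravec x : cl_norm (paravec x) = enorm x.
Proof. by rewrite -[paravec x]mulr1 cl_norm_paravecMl cl_norm1 mulr1. Qed.

Lemma enormD x y : enorm (x + y) <= enorm x + enorm y.
Proof. by rewrite -!cl_norm_paravec paravecD cl_normD. Qed.

Lemma enormZ k x : enorm (k *: x) = `|k| * enorm x.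
Proof. by rewrite -!cl_norm_paravec paravecZ cl_normZ. Qed.

Lemma enorm_eq0 x : enorm x = 0 -> x = 0.
Proof.
move=> x0; apply/rowP => i; rewrite mxE; apply/eqP.
have /eqP : enorm x ^+ 2 = 0 by rewrite x0 expr0n.
rewrite /enorm sqr_sqrtr ?sumr_ge0 // => [|j _]; last exact: sqr_ge0.
rewrite psumr_eq0 => [/allP/(_ i)|j _]; last exact: sqr_ge0.
by rewrite mem_index_enum sqrf_eq0 => /(_ isT).
Qed.

Lemma enorm_continuous : continuous (@enorm R n).
Proof.
move=> x; apply: continuous_comp; last exact: sqrt_continuous.
apply: (continuous_big add_continuous) => i _ {}x.
apply: (@continuous_comp _ _ _ (fun y : 'rV[R]_n.+1 => y 0 i) (fun t => t ^+ 2)).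
  exact: coord_continuous.
exact: exprn_continuous.
Qed.

End EuclideanNorm.

Lemma cvgn_series_eq (R : realType) (u v : nat -> R) :
  u =1 v -> cvgn (series u) -> cvgn (series v).
Proof. by move=> /funext ->. Qed.

(** * Series dominated on balls *)

Section DominatedSeries.
Context {R : realType} {n : nat}.
Notation point := 'rV[R]_n.+1.
(** A set of admissible radii, used both for [inner_radius c] and for the radii below a given
    delta. *)
Variable J : R -> Prop.
Hypothesis J_down : forall r s : R, 0 <= r -> r <= s -> J s -> J r.
Hypothesis J_open : forall r, J r -> exists2 s, r < s & J s.
Implicit Types (u : nat -> point -> clifford R n) (f : point -> clifford R n)
  (x : point) (i : 'I_n.+1).

(** The majorant C_k |x|^(e_k) depends on x through its norm alone and keeps this form under partial
    derivatives, so one predicate covers a series and all its derivatives. *)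
Definition dominated u : Prop := exists e C,
  (forall k, growth (e k) (C k) (u k)) /\
  (forall r : R, 0 <= r -> J r -> cvgn (series (fun k => C k * r ^+ e k))).

(** A single term of the expansion of (r + (s - r))^(k+m). It trades a polynomial factor in k for a
    larger radius: m = 1 for a derivative, m = n - 1 for the comparison of c with b. *)
Lemma binomial_term_le (r s : R) (k m : nat) : 0 <= r -> r <= s ->
  'C(k + m, m)%:R * r ^+ k * (s - r) ^+ m <= s ^+ (k + m).
Proof.
move=> r0 rs; have d0 : 0 <= s - r by rewrite subr_ge0.
have km : (m < (k + m).+1)%N by rewrite ltnS leq_addl.
have -> : s ^+ (k + m) = (r + (s - r)) ^+ (k + m) by rewrite addrCA subrr addr0.
rewrite [in leRHS]exprDn (bigD1 (Ordinal km)) //= addnK -[(_ * _) *+ _]mulr_natl.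
rewrite mulrA lerDl sumr_ge0 // => j _.
by rewrite mulrn_wge0 // mulr_ge0 // exprn_ge0.
Qed.

Lemma summable_deriv (e : nat -> nat) (C : nat -> R) :
  (forall k, 0 <= C k) ->
  (forall r : R, 0 <= r -> J r -> cvgn (series (fun k => C k * r ^+ e k))) ->
  forall r : R, 0 <= r -> J r ->
    cvgn (series (fun k => (e k)%:R * C k * r ^+ (e k).-1)).
Proof.
move=> C0 cC r r0 Jr.
have [s rs Js] := J_open Jr; have sr0 : 0 < s - r by rewrite subr_gt0.
apply: (@series_le_cvg _ _ (fun k => (s - r)^-1 * (C k * s ^+ e k))) => [k|k|k|].
- by rewrite !mulr_ge0 // exprn_ge0.
- by rewrite !mulr_ge0 ?invr_ge0 ?exprn_ge0 ?(ltW sr0) // (le_trans r0) // ltW.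
- rewrite ler_pdivlMl //; case: (e k) => [|d].
    by rewrite !mul0r mulr0 mulr1.
  rewrite [leLHS](_ : _ = C k * (d.+1%:R * r ^+ d * (s - r))); last by ring.
  rewrite ler_wpM2l //.
  by have := binomial_term_le d 1 r0 (ltW rs); rewrite addn1 bin1 expr1.
- exact: (is_cvg_seriesZ (k := (s - r)^-1) (cC _ (le_trans r0 (ltW rs)) Js)).
Qed.

Lemma dominated_pd i u : dominated u ->
  (forall k, is_pd i (u k) (pd i (u k))) /\ dominated (fun k => pd i (u k)).
Proof.
move=> [e [C [gC cC]]].
have H k : is_pd i (u k) (pd i (u k)) /\
    growth (e k).-1 ((e k)%:R * C k) (pd i (u k)).
  by have [du [hdu gdu _]] := growth_is_pd i (gC k); rewrite (is_pd_pd hdu).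
split=> [k|]; first by case: (H k).
exists (fun k => (e k).-1), (fun k => (e k)%:R * C k); split=> [k|].
  by case: (H k).
by apply: summable_deriv => // k; exact: growth_ge0 (gC k).
Qed.

Lemma dominated_bound u x : dominated u -> J (enorm x) ->
  exists M, [/\ forall k A, `|u k x A| <= M k & cvgn (series M)].
Proof.
move=> [e [C [gC cC]]] Jx; exists (fun k => C k * enorm x ^+ e k); split.
  by move=> k A; rewrite (le_trans (cl_norm_comp _ _)) // growth_bound.
by apply: cC => //; exact: enorm_ge0.
Qed.

Lemma cvgn_series_dominated (v M : nat -> R) :
  (forall k, `|v k| <= M k) -> cvgn (series M) -> cvgn (series v).
Proof.
move=> vM cM; apply: normed_cvg; apply: series_le_cvg cM => [k|k|k] //=.
exact: le_trans (vM k).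
Qed.

Lemma dominated_cvg u x : dominated u -> J (enorm x) ->
  exists a, cl_sums_to (u^~ x) a.
Proof.
move=> du Jx; have [M [uM cM]] := dominated_bound du Jx.
exists [ffun A => limn (series (fun k => u k x A))] => A; rewrite ffunE.
by apply: cvgn_series_dominated cM.
Qed.

Lemma is_pd_line i (w dw : point -> clifford R n) x (t : R) A : is_pd i w dw ->
  is_derive t (1 : R) (fun s => w (s *: delta_mx 0 i + x) A)
    (dw (t *: delta_mx 0 i + x) A).
Proof. by move=> h; apply/(is_derive_line (cl_comp w A)); exact: h. Qed.

(** One derivative of f consumes a majorant of the second derivatives of the terms, hence two passes
    through [dominated_pd]. *)
Lemma dominated_derive i u f x : dominated u ->
  (forall y, J (enorm y) -> cl_sums_to (u^~ y) (f y)) -> J (enorm x) ->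
  (forall A, derivable (cl_comp f A) x (delta_mx 0 i)) /\
  cl_sums_to (fun k => pd i (u k) x) (pd i f x).
Proof.
move=> du uf Jx.
have [pdu ddu] := dominated_pd i du; have [pddu dddu] := dominated_pd i ddu.
(* A move by less than delta stays in the closed ball of radius s, where C_k s^(e_k) bounds the
   second derivatives uniformly. *)
have [s xs Js] := J_open Jx; set delta := s - enorm x.
have delta0 : 0 < delta by rewrite subr_gt0.
pose y t := t *: delta_mx 0 i + x : point.
have ys t : `|t| < delta -> enorm (y t) <= s.
  move=> td; rewrite (le_trans (enormD _ _)) // enormZ enorm_delta mulr1.
  by rewrite -lerBrDr ltW.
have Jy t : `|t| < delta -> J (enorm (y t)).
  by move=> td; apply: J_down (ys t td) Js; exact: enorm_ge0.
have [e [C [gC cC]]] := dddu.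
have s0 : 0 <= s by rewrite (le_trans (enorm_ge0 x)) // ltW.
have [a ua] := dominated_cvg ddu Jx.
have y0 : y 0 = x by rewrite /y scale0r add0r.
have H A : is_derive x (delta_mx 0 i) (cl_comp f A) (a A).
  have : is_derive (0 : R) 1 (fun t => cl_comp f A (y t)) (a A).
    apply: (@is_derive_series _ (fun k t => u k (y t) A)
      (fun k t => pd i (u k) (y t) A) (fun k t => pd i (pd i (u k)) (y t) A)
      (fun k => C k * s ^+ e k) delta) => //.
    - exact: cC.
    - by move=> k t _; exact: is_pd_line.
    - by move=> k t _; exact: is_pd_line.
    - move=> k t td; rewrite (le_trans (cl_norm_comp _ _)) //.
      rewrite (le_trans (growth_bound _ (gC k))) // ler_wpM2l ?(growth_ge0 (gC k)) //.
      by rewrite lerXn2r ?nnegrE ?enorm_ge0 ?ys.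
    - by move=> t td; exact: (uf _ (Jy t td)).
    - by rewrite y0; exact: ua.
  by move/(is_derive_line (cl_comp f A)); rewrite -/(y 0) y0.
split=> A; first by have [] := H A.
by rewrite [X in _ --> X]ffunE; have := H A => ?; rewrite derive_val; exact: ua.
Qed.

Lemma cl_sums_to_sum (I : Type) (r : seq I) (u : I -> nat -> clifford R n)
    (a : I -> clifford R n) : (forall j, cl_sums_to (u j) (a j)) ->
  cl_sums_to (fun k => \sum_(j <- r) u j k) (\sum_(j <- r) a j).
Proof.
move=> h A; rewrite sum_ffunE.
have -> : series (fun k => (\sum_(j <- r) u j k) A) =
    fun N => \sum_(j <- r) series (fun k => u j k A) N.
  apply/funext => N; rewrite /series /= exchange_big; apply: eq_bigr => k _.
  by rewrite sum_ffunE.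
by apply: (cvg_big add_continuous) => j _; exact: h.
Qed.

Lemma dominated_sum (I : Type) (r : seq I) e C (u : I -> nat -> point -> clifford R n) :
  (forall j k, growth (e k) (C k) (u j k)) ->
  (forall r : R, 0 <= r -> J r -> cvgn (series (fun k => C k * r ^+ e k))) ->
  dominated (fun k x => \sum_(j <- r) u j k x).
Proof.
move=> gC cC; exists e, (fun k => \sum_(j <- r) C k); split=> [k|s s0 Js].
  elim: r => [|j r IH].
    rewrite big_nil; have := @growth0 R n (e k).
    by congr growth; apply/funext => x; rewrite big_nil.
  rewrite big_cons; have := growthD (gC j k) IH.
  by congr growth; apply/funext => x; rewrite big_cons.
apply: cvgn_series_eq (is_cvg_seriesZ (k := \sum_(j <- r) 1) (cC s s0 Js)) => k.
rewrite -[LHS]/(_ * (C k * s ^+ e k)) mulrA mulr_suml; congr (_ * _).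
by apply: eq_bigr => j _; rewrite mul1r.
Qed.

Lemma near_radius x : J (enorm x) -> \forall y \near x, J (enorm y).
Proof.
move=> Jx; have [s xs Js] := J_open Jx.
have : \forall y \near x, enorm y < s.
  by exact: (cvgr_lt _ (@enorm_continuous R n x)) xs.
by apply: filterS => y ys; apply: J_down (ltW ys) Js; exact: enorm_ge0.
Qed.

Lemma dominated_laplacian u f : dominated u ->
  (forall y, J (enorm y) -> cl_sums_to (u^~ y) (f y)) ->
  [/\ dominated (fun k => laplacian (u k)),
     forall x, J (enorm x) -> laplacian_exists f x &
     forall x, J (enorm x) ->
       cl_sums_to (fun k => laplacian (u k) x) (laplacian f x)].
Proof.
move=> du uf.
have df i x := dominated_derive i du uf (x := x).
have ddf i x : J (enorm x) ->
    (forall A, derivable (cl_comp (pd i f) A) x (delta_mx 0 i)) /\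
    cl_sums_to (fun k => pd i (pd i (u k)) x) (pd i (pd i f) x).
  move=> Jx; apply: (dominated_derive i (dominated_pd i du).2) => // y Jy.
  by have [] := df i y Jy.
split=> [|x Jx A i|x Jx].
- have [e [C [gC cC]]] := du.
  pose e2 k := (e k).-1.-1; pose C2 k := (e k).-1%:R * ((e k)%:R * C k).
  have g2 i k : growth (e2 k) (C2 k) (pd i (pd i (u k))).
    have [d1 [/is_pd_pd E1 g1 _]] := growth_is_pd i (gC k).
    have [d2 [/is_pd_pd E2 g2 _]] := growth_is_pd i g1.
    by rewrite E1 E2.
  have -> : (fun k => laplacian (u k)) =
      fun k x => \sum_(i <- index_enum 'I_n.+1) pd i (pd i (u k)) x.
    by apply/funext => k; apply/funext => x; rewrite laplacianE.
  apply: (dominated_sum _ g2).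
  have C0 k : 0 <= C k := growth_ge0 (gC k).
  apply: summable_deriv; last exact: summable_deriv.
  by move=> k; rewrite mulr_ge0.
- split.
    by apply: filterS (near_radius Jx) => y Jy; have [] := df i y Jy.
  by rewrite -cl_comp_pd; have [] := ddf i x Jx.
- rewrite laplacianE.
  under eq_fun do rewrite laplacianE.
  by apply: cl_sums_to_sum => i; have [] := ddf i x Jx.
Qed.

Lemma dominated_iter_laplacian m u f : dominated u ->
  (forall y, J (enorm y) -> cl_sums_to (u^~ y) (f y)) ->
  [/\ dominated (fun k => iter_laplacian m (u k)),
     iter_laplacian_exists m [set x | J (enorm x)] f &
     forall x, J (enorm x) ->
       cl_sums_to (fun k => iter_laplacian m (u k) x) (iter_laplacian m f x)].
Proof.
move=> du uf; elim: m => [|m [dm em sm]]; first by split.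
have [? ? ?] := dominated_laplacian dm sm; split=> // j.
by rewrite ltnS leq_eqVlt => /predU1P[->//|]; exact: em.
Qed.

End DominatedSeries.

(** * Laplacians of axial functions *)

Section MonomialLaplacian.
Context {R : realType} {n : nat}.
Notation point := 'rV[R]_n.+1.
Implicit Types (u w : point -> clifford R n) (x : point) (i : 'I_n.+1).

Definition is_laplacian u (lu : point -> clifford R n) : Prop :=
  exists d dd, [/\ forall i, is_pd i u (d i), forall i, is_pd i (d i) (dd i) &
                   forall x, lu x = \sum_i dd i x].

Lemma is_laplacianE u lu : is_laplacian u lu -> laplacian u = lu.
Proof.
move=> [d [dd [hd hdd luE]]]; apply/funext => x; rewrite laplacianE luE.
by apply: eq_bigr => i _; rewrite (is_pd_pd (hd i)) (is_pd_pd (hdd i)).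
Qed.

Lemma is_laplacian_sum (I : Type) (r : seq I) (u lu : I -> point -> clifford R n) :
  (forall j, is_laplacian (u j) (lu j)) ->
  is_laplacian (fun x => \sum_(j <- r) u j x) (fun x => \sum_(j <- r) lu j x).
Proof.
move=> /choice[d /choice[dd h]].
exists (fun i x => \sum_(j <- r) d j i x), (fun i x => \sum_(j <- r) dd j i x).
split=> [i|i|x].
- by apply: is_pd_sum => j; have [] := h j.
- by apply: is_pd_sum => j; have [] := h j.
- by rewrite exchange_big; apply: eq_bigr => j _; have [_ _] := h j.
Qed.

Lemma is_pdZ i (s ds : point -> R) u du :
  (forall x, is_derive x (delta_mx 0 i) s (ds x)) -> is_pd i u du ->
  is_pd i (fun x => s x *: u x) (fun x => ds x *: u x + s x *: du x).
Proof.
move=> hs hu x A.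
apply: (is_derive_ext (is_deriveM (hs x) (hu x A))) => [y|].
  by rewrite /cl_comp ffunE.
by rewrite !ffunE addrC; congr (_ + _); exact: mulrC.
Qed.

Lemma is_pd_constZ i k u du :
  is_pd i u du -> is_pd i (fun x => k *: u x) (fun x => k *: du x).
Proof.
move=> hu; have := is_pdZ (fun x => is_derive_cst k x (delta_mx 0 i)) hu.
by congr is_pd; apply/funext => x; rewrite scale0r add0r.
Qed.

Lemma is_laplacianZ k u lu :
  is_laplacian u lu -> is_laplacian (fun x => k *: u x) (fun x => k *: lu x).
Proof.
move=> [d [dd [hd hdd luE]]].
exists (fun i x => k *: d i x), (fun i x => k *: dd i x).
by split=> [i|i|x]; [exact: is_pd_constZ|exact: is_pd_constZ|rewrite luE scaler_sumr].
Qed.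

Definition radial (a b : nat) x : R := x 0 ord0 ^+ a * vec_sqr x ^+ b.

(** [unlift ord0 i] is [None] exactly for the real coordinate. Truncated predecessors are harmless
    here and in [dd_radial]: their prefactors vanish. *)
Definition d_radial i (a b : nat) x : R :=
  if unlift ord0 i is Some _ then b%:R * 2 * x 0 i * radial a b.-1 x
  else a%:R * radial a.-1 b x.

Definition dd_radial i (a b : nat) x : R :=
  if unlift ord0 i is Some _ then
    b%:R * 2 * radial a b.-1 x +
    b%:R * b.-1%:R * 4 * (x 0 i ^+ 2 * radial a b.-2 x)
  else a%:R * a.-1%:R * radial a.-2 b x.

Lemma is_derive_pow (f : point -> R) (p : nat) x (v : point) (d : R) :
  is_derive x v f d ->
  is_derive x v (fun y => f y ^+ p) (p%:R * f x ^+ p.-1 * d).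
Proof.
move=> h; apply: (is_derive_ext (is_deriveX p h)) => // y.
by rewrite exprfctE.
Qed.

Lemma is_derive_mul (f g : point -> R) x (v : point) (df dg : R) :
  is_derive x v f df -> is_derive x v g dg ->
  is_derive x v (fun y => f y * g y) (df * g x + f x * dg).
Proof.
move=> hf hg; apply: (is_derive_ext (is_deriveM hf hg)) => //.
by rewrite addrC; congr (_ + _); exact: mulrC.
Qed.

Lemma is_derive_scale (k : R) (f : point -> R) x (v : point) (d : R) :
  is_derive x v f d -> is_derive x v (fun y => k * f y) (k * d).
Proof. by move=> h; apply: (is_derive_ext (is_deriveZ k h)). Qed.

Lemma is_derive_vec_sqr i x :
  is_derive x (delta_mx 0 i) (@vec_sqr R n)
    (if unlift ord0 i is Some _ then 2 * x 0 i else 0).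
Proof.
have h (l : 'I_n) :=
  is_derive_pow 2 (is_derive_coord x (delta_mx 0 i : point) (lift ord0 l)).
apply: (is_derive_ext (@is_derive_bigsum _ _ _ (index_enum _) xpredT _ _ _ _ h)) => //.
case: unliftP => [l ->|->]; last first.
  by rewrite big1 // => l _; rewrite mxE /= mulr0.
rewrite (bigD1 l) //= big1 => [|j jl].
  by rewrite mxE !eqxx mulr1 addr0 expr1.
by rewrite mxE (inj_eq lift_inj) (negPf jl) andbF mulr0.
Qed.

Lemma is_derive_radial i (a b : nat) x :
  is_derive x (delta_mx 0 i) (radial a b) (d_radial i a b x).
Proof.
have h := is_derive_mul
  (is_derive_pow a (is_derive_coord x (delta_mx 0 i : point) ord0))
  (is_derive_pow b (is_derive_vec_sqr i x)).
apply: (is_derive_ext h) => //.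
rewrite /d_radial /radial; case: unliftP => [l ->|->].
  by rewrite mxE /= mulr0 mul0r add0r; ring.
by rewrite mxE /= mulr0 mulr0 addr0; ring.
Qed.

Lemma is_derive_d_radial i (a b : nat) x :
  is_derive x (delta_mx 0 i) (d_radial i a b) (dd_radial i a b x).
Proof.
rewrite /d_radial /dd_radial; case: unliftP => [l ->|->].
  have hr := is_derive_radial (lift ord0 l) a b.-1 x.
  have hc := is_derive_coord x (delta_mx 0 (lift ord0 l) : point) (lift ord0 l).
  have h := is_derive_scale (b%:R * 2) (is_derive_mul hc hr).
  apply: (is_derive_ext h) => [y|]; first by rewrite mulrA.
  rewrite /d_radial liftK mxE !eqxx mul1r; ring.
have h := is_derive_scale a%:R (is_derive_radial ord0 a.-1 b x).
apply: (is_derive_ext h) => //.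
by rewrite /d_radial unlift_none mulrA.
Qed.

(** In the vector directions the constant parts add up to 2bn, while the squares x_i^2 rebuild
    [vec_sqr x] and contribute 4b(b - 1). *)
Lemma sum_dd_radial (a b : nat) x : \sum_i dd_radial i a b x =
  a%:R * a.-1%:R * radial a.-2 b x +
  2 * b%:R * (n%:R + 2 * b%:R - 2) * radial a b.-1 x.
Proof.
rewrite big_ord_recl /dd_radial unlift_none; congr (_ + _).
under eq_bigr do rewrite liftK.
rewrite big_split /= sumr_const card_ord -mulr_sumr -mulr_suml -/(vec_sqr x).
have -> : b%:R * b.-1%:R * 4 * (vec_sqr x * radial a b.-2 x) =
    b%:R * (b%:R - 1) * 4 * radial a b.-1 x.
  case: b => [|[|b]]; rewrite /radial ?mul0r ?subrr ?mulr0 ?mul0r //=.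
  by rewrite exprS -[b.+2]addn1 natrD addrK; ring.
by rewrite -mulr_natr; ring.
Qed.

Lemma is_laplacian_radial a b beta : is_laplacian (fun x => radial a b x *: beta)
  (fun x => (a%:R * a.-1%:R * radial a.-2 b x +
    2 * b%:R * (n%:R + 2 * b%:R - 2) * radial a b.-1 x) *: beta).
Proof.
exists (fun i x => d_radial i a b x *: beta), (fun i x => dd_radial i a b x *: beta).
split=> [i|i|x]; last by rewrite -sum_dd_radial scaler_suml.
- have := is_pdZ (is_derive_radial i a b) (is_pd_cst i beta).
  by congr is_pd; apply/funext => x; rewrite scaler0 addr0.
- have := is_pdZ (is_derive_d_radial i a b) (is_pd_cst i beta).
  by congr is_pd; apply/funext => x; rewrite scaler0 addr0.
Qed.

Lemma is_pd_vec_part i : is_pd i (@vec_part R n) (fun=> vec_part (delta_mx 0 i)).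
Proof.
rewrite /vec_part => x A; apply: (is_derive_ext (is_pd_sum (index_enum _) xpredT
     (fun l : 'I_n => is_pd_coordZ i (lift ord0 l) (cl_gen l)) x A)) => //.
by congr (fun_of_fin _ A); apply: eq_bigr => l _; rewrite mxE.
Qed.

Lemma vec_part_delta i : vec_part (delta_mx 0 i : point) =
  if unlift ord0 i is Some l then cl_gen l else 0.
Proof.
rewrite /vec_part; case: unliftP => [l ->|->]; last first.
  by rewrite big1 // => l _; rewrite mxE /= scale0r.
rewrite (bigD1 l) //= big1 => [|j jl].
  by rewrite mxE !eqxx scale1r addr0.
by rewrite mxE (inj_eq lift_inj) (negPf jl) andbF scale0r.
Qed.

Lemma sum_d_radial_vec a b x :
  \sum_i d_radial i a b x *: vec_part (delta_mx 0 i : point) =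
  (b%:R * 2 * radial a b.-1 x) *: vec_part x.
Proof.
rewrite big_ord_recl vec_part_delta unlift_none scaler0 add0r.
rewrite /vec_part scaler_sumr; apply: eq_bigr => l _.
rewrite -/(vec_part _) vec_part_delta /d_radial liftK scalerA.
by congr (_ *: _); ring.
Qed.

(** v is linear, so the product rule adds only a cross term to the radial case; by
    [sum_d_radial_vec] it contributes 4b, which turns n + 2b - 2 into n + 2b. *)
Lemma is_laplacian_radial_vec a b beta :
  is_laplacian (fun x => radial a b x *: (vec_part x * beta))
  (fun x => (a%:R * a.-1%:R * radial a.-2 b x +
    2 * b%:R * (n%:R + 2 * b%:R) * radial a b.-1 x) *: (vec_part x * beta)).
Proof.
pose w x := vec_part x * beta; pose dw i := vec_part (delta_mx 0 i : point) * beta.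
have hw i : is_pd i w (fun=> dw i).
  have := is_pdM (is_pd_vec_part i) (is_pd_cst i beta).
  by congr is_pd; apply/funext => x; rewrite mulr0 addr0.
have hr i := is_derive_radial i a b; have hdr i := is_derive_d_radial i a b.
exists (fun i x => d_radial i a b x *: w x + radial a b x *: dw i).
exists (fun i x => (dd_radial i a b x *: w x + d_radial i a b x *: dw i) +
          (d_radial i a b x *: dw i + radial a b x *: 0)).
split=> [i|i|x]; first exact: is_pdZ.
  by apply: is_pdD; apply: is_pdZ => //; exact: is_pd_cst.
rewrite !big_split /= -scaler_suml sum_dd_radial.
rewrite [X in _ + (_ + X)]big1 ?addr0 => [|i _]; last by rewrite scaler0.
have -> : \sum_i d_radial i a b x *: dw i = (b%:R * 2 * radial a b.-1 x) *: w x.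
  rewrite /w cl_scalerAl -sum_d_radial_vec mulr_suml; apply: eq_bigr => i _.
  by rewrite -cl_scalerAl.
rewrite -[RHS]addrA -[in RHS]scalerDl -[in RHS]scalerDl; congr (_ *: _); ring.
Qed.

End MonomialLaplacian.

Section AxialLaplacian.
Context {R : realType} {n : nat}.
Notation point := 'rV[R]_n.+1.
Implicit Types (x : point) (beta : clifford R n).

Definition axial (a j : nat) beta x : clifford R n :=
  x 0 ord0 ^+ a *: (vec_part x ^+ j * beta).

Lemma vec_partX_double x (b : nat) :
  vec_part x ^+ b.*2 = ((-1) ^+ b * vec_sqr x ^+ b)%:A.
Proof.
rewrite -muln2 mulnC exprM vec_part_sqr -scaleNr -mulN1r -exprMn.
elim: b => [|b IH]; first by rewrite !expr0 scale1r.
by rewrite exprS IH mulr_algl scalerA -exprS.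
Qed.

Lemma axial_even a b beta :
  axial a b.*2 beta = fun x => (-1) ^+ b *: (radial a b x *: beta).
Proof.
apply/funext => x; rewrite /axial vec_partX_double mulr_algl !scalerA.
by congr (_ *: _); rewrite /radial; ring.
Qed.

Lemma axial_odd a b beta :
  axial a b.*2.+1 beta =
  fun x => (-1) ^+ b *: (radial a b x *: (vec_part x * beta)).
Proof.
apply/funext => x; rewrite /axial exprSr vec_partX_double -mulrA mulr_algl.
by rewrite !scalerA; congr (_ *: _); rewrite /radial; ring.
Qed.

(* The Laplacian maps v ^ j, v the vector part, to - vec_eigen j * v ^ (j - 2):
   v ^ (2 b) = (- |v|^2) ^ b is radial on R^n and v ^ (2 b + 1) = (- |v|^2) ^ b v. *)
Definition vec_eigen (j : nat) : R :=
  if odd j then j.-1%:R * (j.-1%:R + n%:R) else j%:R * (j%:R + n%:R - 2).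

Lemma is_laplacian_axial a j beta :
  is_laplacian (axial a j beta)
    (fun x => (a%:R * a.-1%:R) *: axial a.-2 j beta x
              - vec_eigen j *: axial a j.-2 beta x).
Proof.
have [b] : exists b, j = b.*2 \/ j = b.*2.+1.
  exists j./2; have := odd_double_half j.
  by case: (odd j) => /esym; [right|left].
have dbl : b.*2%:R = 2 * b%:R :> R by rewrite -muln2 natrM mulrC.
case=> ->.
  rewrite axial_even; have := is_laplacianZ ((-1) ^+ b) (is_laplacian_radial a b beta).
  congr is_laplacian; apply/funext => x.
  rewrite /vec_eigen odd_double dbl axial_even.
  case: b {dbl} => [|b].
    by rewrite !mulr0 !mul0r scale0r subr0 addr0 expr0 !scale1r scalerA.
  rewrite doubleS /= axial_even !scalerA -scalerBl; congr (_ *: _).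
  by rewrite exprS; ring.
rewrite axial_odd; have := is_laplacianZ ((-1) ^+ b) (is_laplacian_radial_vec a b beta).
congr is_laplacian; apply/funext => x.
rewrite /vec_eigen /= odd_double /= dbl axial_odd.
case: b {dbl} => [|b].
  by rewrite !mulr0 !mul0r scale0r subr0 addr0 expr0 !scale1r scalerA.
rewrite doubleS /= axial_odd !scalerA -scalerBl; congr (_ *: _).
by rewrite exprS; ring.
Qed.

(* The factorials make x0 ^ a / a! an Appell sequence, so that the Laplacian acts
   on the coefficients kappa alone. *)
Definition axial_sum (kappa : nat -> R) (K : nat) beta x : clifford R n :=
  \sum_(j < K.+1) (kappa j / ((K - j)`!%:R * j`!%:R)) *: axial (K - j) j beta x.

Lemma natr_fact_neq0 k : k`!%:R != 0 :> R.
Proof. by rewrite pnatr_eq0 -lt0n fact_gt0. Qed.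

Lemma is_laplacian_axial_sum kappa K beta :
  is_laplacian (axial_sum kappa K beta) (fun x =>
    \sum_(j < K.+1) (kappa j / ((K - j)`!%:R * j`!%:R)) *:
      (((K - j)%:R * (K - j).-1%:R) *: axial (K - j).-2 j beta x
        - vec_eigen j *: axial (K - j) j.-2 beta x)).
Proof.
by apply: is_laplacian_sum => j; apply: is_laplacianZ; exact: is_laplacian_axial.
Qed.

Lemma vec_eigen0 : vec_eigen 0%N = 0.
Proof. by rewrite /vec_eigen /= mulr0n mul0r. Qed.

Lemma vec_eigen1 : vec_eigen 1%N = 0.
Proof. by rewrite /vec_eigen /= mulr0n mul0r. Qed.

(** The real direction preserves j and the vector directions lower it by 2, so the new coefficient
    at j mixes the old ones at j and j + 2; the factorials account for the quotient by
    (j+2)(j+1). *)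
Lemma laplacian_axial_sum kappa K beta :
  laplacian (axial_sum kappa K.+2 beta) =
  axial_sum (fun j =>
    kappa j - vec_eigen j.+2 / (j.+2%:R * j.+1%:R) * kappa j.+2) K beta.
Proof.
rewrite (is_laplacianE (is_laplacian_axial_sum _ _ _)); apply/funext => x.
rewrite /axial_sum.
under eq_bigr do rewrite scalerBr; rewrite sumrB.
(* The two top terms are of degree at most 1 in x0, and the two bottom ones have zero eigenvalue;
   without them both sums have the same range. *)
rewrite 2!big_ord_recr /= subnn subSnn /=.
rewrite mul0r mulr0 !scale0r !scaler0 !addr0.
rewrite [X in _ - X]big_ord_recl [X in _ - (_ + X)]big_ord_recl /=.
rewrite vec_eigen0 vec_eigen1 !scale0r !scaler0 !add0r -sumrB.
apply: eq_bigr => j _; have jK : (j <= K)%N by rewrite -ltnS.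
rewrite /bump /= !add1n !subSS.
rewrite (subSn (leqW jK)) (subSn jK) /= !scalerA -scalerBl; congr (_ *: _).
rewrite !factS !natrM.
field.
by rewrite !natr_fact_neq0 !nat1r -!natrD !pnatr_eq0.
Qed.

Lemma laplacian_axial_sum0 kappa K beta :
  (K < 2)%N -> laplacian (axial_sum kappa K beta) = fun=> 0.
Proof.
move=> K2; rewrite (is_laplacianE (is_laplacian_axial_sum _ _ _)).
apply/funext => x; apply: big1 => j _.
have -> : vec_eigen j = 0.
  case: j K2 => -[|[|j]] //= jK K2; rewrite ?vec_eigen0 ?vec_eigen1 //.
  by case: K jK K2 => [|[|]].
rewrite scale0r subr0; have : (K - j < 2)%N by rewrite (leq_ltn_trans (leq_subr _ _)).
by case: (K - j)%N => [|[|]] //= _; rewrite ?mul0r ?mulr0 scale0r scaler0.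
Qed.

Lemma laplacian_zero : laplacian (fun=> 0 : clifford R n) = fun=> 0.
Proof.
have := @laplacian_axial_sum0 (fun=> 0) 0 0 isT.
suff -> : axial_sum (fun=> 0) 0 0 = fun=> 0 by [].
by apply/funext => x; apply: big1 => j _; rewrite /axial mulr0 !scaler0.
Qed.

End AxialLaplacian.

(** * The Clifford-Appell polynomials *)

Section AppellExpansion.
Context {R : realType} {n : nat}.
Hypothesis n_gt0 : (0 < n)%N.
Notation p := ((n%:R + 1) / 2 : R).
Notation q := ((n%:R - 1) / 2 : R).

Lemma pochS (a : R) s : poch a s.+1 = poch a s * (a + s%:R).
Proof. by rewrite /poch big_ord_recr. Qed.

Lemma poch0 (a : R) : poch a 0 = 1.
Proof. by rewrite /poch big_ord0. Qed.

Lemma poch_neq0 K : poch n%:R K != 0 :> R.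
Proof.
apply/prodf_neq0 => i _; rewrite -natrD pnatr_eq0 addn_eq0.
by rewrite -leqn0 leqNgt n_gt0.
Qed.

Lemma mul_bin_leftr k s : ((k.+1 - s)%:R * 'C(k.+1, s)%:R = k.+1%:R * 'C(k, s)%:R :> R).
Proof. by rewrite -!natrM -mul_bin_down. Qed.

(** Both binomial factors reduce to (K+1) C(K,s), and the new Pochhammer factors p + (K - s) and q +
    s add up to n + K, the last factor of (n)_(K+1). *)
Lemma appell_coefE K s : (s <= K)%N ->
  (K.+1 - s)%:R * appell_coef n K.+1 s + s.+1%:R * appell_coef n K.+1 s.+1 =
  K.+1%:R * appell_coef n K s :> R.
Proof.
move=> sK; rewrite /appell_coef subSS !mulrA mul_bin_leftr.
have -> : s.+1%:R * 'C(K.+1, s.+1)%:R = K.+1%:R * 'C(K, s)%:R :> R.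
  by rewrite -!natrM -mul_bin_diag.
rewrite (subSn sK) !pochS natrB //.
have := poch_neq0 K; have := poch_neq0 K.+1; rewrite pochS mulf_eq0 negb_or.
move=> /andP[? ?] _; field; exact/andP.
Qed.

Definition alt_sum (a b : R) (j : nat) : R :=
  \sum_(s < j.+1) (-1) ^+ s * ('C(j, s)%:R * (poch a (j - s) * poch b s)).

(* alt_sum a b j / j! is the coefficient of t ^ j in
   F t = (1 - t) ^ (- a) (1 + t) ^ (- b), and the recursion expresses
   (1 - t ^ 2) F' = (a - b + (a + b) t) F. *)
Lemma alt_sumS (a b : R) j : alt_sum a b j.+2 =
  (a - b) * alt_sum a b j.+1 + j.+1%:R * (a + b + j%:R) * alt_sum a b j.
Proof.
pose U i s := poch a i * poch b s.
have pascal : alt_sum a b j.+2 = \sum_(s < j.+2) (-1) ^+ s * 'C(j.+1, s)%:R *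
    (U (j.+2 - s)%N s - U (j.+1 - s)%N s.+1).
  rewrite /alt_sum big_ord_recl /= bin0.
  under eq_bigr => s _.
    rewrite /bump /= add1n binS natrD subSS mulrDl mulrDr exprS mulN1r.
    over.
  rewrite big_split /= addrA; under [RHS]eq_bigr do rewrite mulrBr.
  rewrite sumrB; congr (_ + _).
    rewrite big_ord_recr /= bin_small // mul0r mulr0 addr0.
    rewrite [RHS]big_ord_recl /= bin0 mulr1 mul1r; congr (_ + _).
    by apply: eq_bigr => s _; rewrite /bump /= add1n exprS !subSS -/(U _ _); ring.
  by rewrite -sumrN; apply: eq_bigr => s _; rewrite -/(U _ _); ring.
rewrite pascal.
(* The two products share all factors but one: a + (j+1-s) in the first, b + s in the second. *)
have step s : (s <= j.+1)%N -> U (j.+2 - s)%N s - U (j.+1 - s)%N s.+1 =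
    (a - b + ((j.+1 - s)%:R - s%:R)) * U (j.+1 - s)%N s.
  by move=> sj; rewrite subSn // /U !pochS; ring.
transitivity (\sum_(s < j.+2) ((a - b) *
      ((-1) ^+ s * ('C(j.+1, s)%:R * U (j.+1 - s)%N s)) +
   ((-1) ^+ s * ((j.+1 - s)%:R * 'C(j.+1, s)%:R) * U (j.+1 - s)%N s -
    (-1) ^+ s * (s%:R * 'C(j.+1, s)%:R) * U (j.+1 - s)%N s))).
  by apply: eq_bigr => s _; rewrite step -1?ltnS //; ring.
rewrite big_split /= -mulr_sumr; congr (_ + _).
rewrite sumrB big_ord_recr /= subnn mul0r mulr0 mul0r addr0.
rewrite [X in _ - X]big_ord_recl /= mul0r mulr0 mul0r add0r -sumrB.
rewrite /alt_sum mulr_sumr; apply: eq_bigr => s _; have sj : (s <= j)%N by rewrite -ltnS.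
rewrite mul_bin_leftr /bump /= add1n subSS exprS.
have -> : s.+1%:R * 'C(j.+1, s.+1)%:R = j.+1%:R * 'C(j, s)%:R :> R.
  by rewrite -!natrM -mul_bin_diag.
by rewrite (subSn sj) /U !pochS natrB //; ring.
Qed.

(** At x0 = 0 the paravector is v and its conjugate is -v, so P_j takes the value [appell_alt j]
    times v^j. *)
Definition appell_alt (j : nat) : R :=
  \sum_(s < j.+1) (-1) ^+ s * appell_coef n j s.

Lemma appell_altE j : appell_alt j = alt_sum p q j / poch n%:R j.
Proof.
by rewrite /appell_alt /alt_sum mulr_suml; apply: eq_bigr => s _; rewrite !mulrA.
Qed.

Lemma appell_alt0 : appell_alt 0 = 1.
Proof.
rewrite /appell_alt big_ord_recl big_ord0 /appell_coef !poch0 bin0.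
by rewrite expr0 !mul1r invr1 addr0.
Qed.

Lemma appell_alt1 : n%:R * appell_alt 1 = 1.
Proof.
rewrite appell_altE /alt_sum !big_ord_recl big_ord0 /= /bump /= !pochS !poch0.
have n0 : n%:R != 0 :> R by rewrite pnatr_eq0 -lt0n.
by rewrite !bin0 binn expr0 expr1; field.
Qed.

(** This is [alt_sumS] with p - q = 1 and p + q = n, divided by (n)_(j+2). *)
Lemma appell_altS j : (n%:R + j.+1%:R) * appell_alt j.+2 =
  appell_alt j.+1 + j.+1%:R * appell_alt j.
Proof.
rewrite !appell_altE alt_sumS !pochS.
have := poch_neq0 j.+2; rewrite !pochS !mulf_eq0 !negb_or => /andP[/andP[? ?] ?].
by field; apply/and3P.
Qed.

(* The Clifford-Appell polynomial as a polynomial in x0 (outer variable) and in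
   the vector part (inner variable), which commute. By the Appell property
   deriv_appell_poly it is determined by its values at x0 = 0. *)
Definition appell_poly (K : nat) : {poly {poly R}} :=
  \sum_(s < K.+1) (appell_coef n K s)%:P%:P *
    (('X + 'X%:P) ^+ (K - s) * ('X - 'X%:P) ^+ s).

Lemma deriv_appell_poly K : (appell_poly K.+1)^`() = K.+1%:R *: appell_poly K.
Proof.
rewrite /appell_poly raddf_sum scaler_sumr /=.
pose c s : {poly {poly R}} := (appell_coef n K.+1 s)%:P%:P.
pose z : {poly {poly R}} := 'X + 'X%:P; pose w : {poly {poly R}} := 'X - 'X%:P.
transitivity (\sum_(s < K.+2)
    ((K.+1 - s)%:R * c s * (z ^+ (K - s) * w ^+ s) +
     s%:R * c s * (z ^+ (K.+1 - s) * w ^+ s.-1))).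
  apply: eq_bigr => s _.
  rewrite derivM !derivC mul0r add0r derivM !deriv_exp derivB derivD derivX derivC.
  rewrite subr0 addr0 !mul1r subSKn -/z -/w -/(c s) mulrDr.
  congr (_ + _); last by rewrite !mulrnAr -[LHS]mulr_natl mulrA.
  by rewrite [_ *+ _ * w ^+ s]mulrnAl mulrnAr -[LHS]mulr_natl mulrA.
rewrite big_split big_ord_recr /= subnn !mul0r addr0.
rewrite [X in _ + X]big_ord_recl /= !mul0r add0r -big_split.
apply: eq_bigr => s _; have sK : (s <= K)%N by rewrite -ltnS.
rewrite /bump /= add1n subSS -mulrDl -[RHS]mul_polyC polyC_natr [RHS]mulrA.
rewrite -/z -/w; congr (_ * _).
have nE k : k%:R = (k%:R : R)%:P%:P :> {poly {poly R}} by rewrite !polyC_natr.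
by rewrite /c !nE -!polyCM -!polyCD appell_coefE.
Qed.

Lemma coef_appell_poly K a :
  (appell_poly K)`_a = 'C(K, a)%:R *: ((appell_poly (K - a))`_0).
Proof.
elim: a K => [|a IH] K; first by rewrite bin0 scale1r subn0.
case: K => [|K].
  rewrite bin0n scale0r /appell_poly big_ord_recl big_ord0 addr0 !expr0 !mulr1.
  by rewrite coefC.
have /(congr1 (fun P : {poly {poly R}} => P`_a)) := deriv_appell_poly K.
rewrite coef_deriv coefZ IH => h; rewrite subSS.
have a1 : a.+1%:R != 0 :> R by rewrite pnatr_eq0.
apply: (scalerI a1); rewrite [LHS]scaler_nat h scalerA -natrM -mul_bin_diag natrM.
by rewrite -scalerA [RHS]scaler_nat mulr_natl.
Qed.

Lemma appell_poly_coef0 j : (appell_poly j)`_0 = appell_alt j *: 'X^j.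
Proof.
rewrite -horner_coef0 /appell_poly horner_sum scaler_suml; apply: eq_bigr => s _.
have sj : (s <= j)%N by rewrite -ltnS.
move: (appell_coef n j s) => c.
rewrite !hornerE /= [(- 'X) ^+ s]exprNn mulrACA -exprD subnK // -mul_polyC.
by congr (_ * _); rewrite polyCM polyC_exp polyCN mulrC.
Qed.

Lemma appell_polyE K (c : {poly R}) : (appell_poly K).[c] =
  \sum_(j < K.+1) ('C(K, j)%:R * appell_alt j) *: ('X^j * c ^+ (K - j)).
Proof.
have szK : (size (appell_poly K) <= K.+1)%N.
  by apply/leq_sizeP => a Ka; rewrite coef_appell_poly bin_small // scale0r.
rewrite (horner_coef_wide _ szK) (reindex_inj rev_ord_inj) /=.
apply: eq_bigr => j _; have jK : (j <= K)%N by rewrite -ltnS.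
rewrite subSS coef_appell_poly subKn // appell_poly_coef0 bin_sub //.
by rewrite scalerA -scalerAl.
Qed.

Lemma appell_axial K (x : 'rV[R]_n.+1) beta :
  appell K x * beta = axial_sum appell_alt K (K`!%:R *: beta) x.
Proof.
(* x and its conjugate lie in the commutative subalgebra generated by v, so polynomial identities
   transfer by evaluation at v. *)
pose phi : {rmorphism {poly R} -> clifford R n} := horner_alg (vec_part x).
have phiX : phi 'X = vec_part x by exact: horner_algX.
have phiC c : phi c%:P = c%:A by exact: horner_algC.
have -> : appell K x = phi (appell_poly K).[(x 0 ord0)%:P].
  rewrite /appell_poly horner_sum rmorph_sum; apply: eq_bigr => s _.
  move: (appell_coef n K s) => c.
  rewrite !hornerE !rmorphM !rmorphXn /= !rmorphD !rmorphN /= phiX !phiC.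
  by rewrite -mulrA mulr_algl.
rewrite appell_polyE rmorph_sum mulr_suml; apply: eq_bigr => j _.
have jK : (j <= K)%N by rewrite -ltnS.
move: (appell_alt j) => t.
rewrite -mul_polyC !rmorphM !rmorphXn /= !phiX !phiC /axial.
rewrite exprZn expr1n mulr_algr -!mulrA !mulr_algl -scalerAl -!scalerAr !scalerA.
rewrite mulr_algl scalerA; congr (_ *: _); rewrite -(bin_fact jK) !natrM.
by field; rewrite !natr_fact_neq0.
Qed.

End AppellExpansion.

(** * The Fueter-Sce map on monomials *)

Section FueterSce.
Context {R : realType} {n : nat}.
Hypothesis n_odd : odd n.
Notation m := n.-1./2.
Implicit Types (beta : clifford R n) (x : 'rV[R]_n.+1).

Lemma odd_dimE : n = m.*2.+1.
Proof. by case: n n_odd => //= k /negPf ok; rewrite -{1}(odd_double_half k) ok. Qed.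

(* The coefficients of the i-th iterated Laplacian of x ^ k / k! in axial form;
   as functions of j they only depend on uphalf j. *)
Definition sce_kappa (i j : nat) : R := \prod_(l < i)
  ((l.*2%:R - (n%:R - 1)) / ((uphalf j).*2.+1%:R + l.*2%:R)).

Definition odd_prod (i h : nat) : R := \prod_(l < i) (h.*2.+1%:R + l.*2%:R).

Lemma odd_prodS i h : odd_prod i.+1 h = odd_prod i h * (h.*2.+1%:R + i.*2%:R).
Proof. by rewrite /odd_prod big_ord_recr. Qed.

Lemma odd_prod_shift i h :
  odd_prod i h * (h.*2.+1%:R + i.*2%:R) = h.*2.+1%:R * odd_prod i h.+1.
Proof.
rewrite -odd_prodS /odd_prod big_ord_recl addr0; congr (_ * _).
by apply: eq_bigr => l _; rewrite -!natrD !doubleS !addSn !addnS.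
Qed.

Lemma odd_prod_neq0 i h : odd_prod i h != 0.
Proof. by apply/prodf_neq0 => l _; rewrite -natrD pnatr_eq0. Qed.

Lemma sce_kappaE i j : sce_kappa i j =
  \prod_(l < i) (l.*2%:R - (n%:R - 1)) / odd_prod i (uphalf j).
Proof. by rewrite /sce_kappa prodf_div. Qed.

(** One of the factors j + 2 (j even), j + 1 (j odd) cancels, and both parities give (2h + n) / (2h
    + 1) with h = [uphalf j]. *)
Lemma vec_eigenE j : vec_eigen (n := n) j.+2 / (j.+2%:R * j.+1%:R) =
  ((uphalf j).*2.+1%:R + n%:R - 1) / (uphalf j).*2.+1%:R :> R.
Proof.
have := odd_double_half j; rewrite /vec_eigen uphalf_half /= negbK.
case: (odd j) => /= <-; move: j./2 => b; rewrite ?add1n ?add0n ?doubleS.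
  rewrite -[b.*2.+1./2]/(uphalf b.*2) uphalf_double.
  have -> : b.*2.+3%:R = b.*2%:R + 3 :> R by rewrite -natrD addn3.
  have -> : b.*2.+2%:R = b.*2%:R + 2 :> R by rewrite -natrD addn2.
  by field; rewrite -!natrD !addn3 !addn2 !pnatr_eq0.
rewrite doubleK; have -> : b.*2.+1%:R = b.*2%:R + 1 :> R by rewrite -natr1.
have -> : b.*2.+2%:R = b.*2%:R + 2 :> R by rewrite -natrD addn2.
by field; rewrite ?nat1r ?natr1 -?natrD ?addn2 ?add2n !pnatr_eq0.
Qed.

(** Replacing h by h + 1 multiplies kappa_i by (2h+1) / (2h+1+2i), so the right-hand side is kappa_i
    times 1 - (2h+n) / (2h+1+2i), which is the next factor of the product. *)
Lemma sce_kappaS i j : sce_kappa i.+1 j = sce_kappa i j -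
  vec_eigen (n := n) j.+2 / (j.+2%:R * j.+1%:R) * sce_kappa i j.+2.
Proof.
rewrite vec_eigenE !sce_kappaE big_ord_recr /= odd_prodS.
move: (uphalf j) => h; set N := \prod_(l < i) _.
have h0 : h.*2.+1%:R != 0 :> R by rewrite pnatr_eq0.
have hi : h.*2.+1%:R + i.*2%:R != 0 :> R by rewrite -natrD pnatr_eq0.
have q0 := odd_prod_neq0 i h; have q1 := odd_prod_neq0 i h.+1.
have E : odd_prod i h.+1 = odd_prod i h * (h.*2.+1%:R + i.*2%:R) / h.*2.+1%:R.
  by rewrite odd_prod_shift mulrC mulKf.
by rewrite E; field; rewrite !nat1r h0 hi q0.
Qed.

Lemma iter_laplacian_axial_sum i K beta :
  iter_laplacian i (axial_sum (fun=> 1) K beta) =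
  if (i.*2 <= K)%N then axial_sum (sce_kappa i) (K - i.*2) beta else fun=> 0.
Proof.
elim: i => [|i IH].
  rewrite subn0 /=; congr (axial_sum _ _ _).
  by apply/funext => j; rewrite /sce_kappa big_ord0.
rewrite /iter_laplacian iterS -/(iter_laplacian _ _) IH doubleS.
case: (leqP i.*2 K) => Ki; last first.
  by rewrite laplacian_zero ltnNge leqW // ltnW.
case: (leqP i.*2.+2 K) => Ki'.
  have -> : (K - i.*2 = (K - i.*2.+2).+2)%N.
    by rewrite -[in LHS](subnK Ki') -!addSnnS addnK.
  rewrite laplacian_axial_sum; congr (axial_sum _ _ _).
  by apply/funext => j; rewrite sce_kappaS.
by rewrite laplacian_axial_sum0 // ltn_subLR // addn2.
Qed.

Lemma monomial_axial k x beta :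
  monomial k x * beta = axial_sum (fun=> 1) k (k`!%:R *: beta) x.
Proof.
rewrite /monomial /paravec exprDn_comm; last first.
  by rewrite /GRing.comm mulr_algl mulr_algr.
rewrite mulr_suml; apply: eq_bigr => j _; have jk : (j <= k)%N by rewrite -ltnS.
rewrite /axial exprZn expr1n mulr_algl -scaler_nat -!scalerAl -!scalerAr !scalerA.
congr (_ *: _); rewrite -(bin_fact jk) !natrM.
by field; rewrite !natr_fact_neq0.
Qed.

Lemma sce_kappa_shift h :
  (h.*2.+1%:R + m.*2%:R) * sce_kappa m h.*2.+2 = h.*2.+1%:R * sce_kappa m h.*2.
Proof.
rewrite !sce_kappaE -doubleS !uphalf_double; set N := \prod_(l < m) _.
have := odd_prod_shift m h; have := odd_prod_neq0 m h; have := odd_prod_neq0 m h.+1.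
move: (odd_prod m h) (odd_prod m h.+1) => u v v0 u0 E.
apply: (mulIf u0); apply: (mulIf v0).
by rewrite mulrAC !mulrA divfK // mulrAC divfK // [RHS]mulrAC -E; ring.
Qed.

Lemma sce_kappa_odd h : sce_kappa m h.*2.+1 = sce_kappa m h.*2.+2.
Proof. by rewrite !sce_kappaE -doubleS uphalf_double /= doubleK. Qed.

(** The value m enters through n = 2m + 1. As kappa agrees at 2h + 1 and 2h + 2, either parity
    reduces to [sce_kappa_shift]. *)
Lemma sce_kappaSS j : (n%:R + j.+1%:R) * sce_kappa m j.+2 =
  sce_kappa m j.+1 + j.+1%:R * sce_kappa m j.
Proof.
have nE : n%:R = m.*2%:R + 1 :> R by rewrite {1}odd_dimE -natr1.
rewrite -[j]odd_double_half; move: j./2 => h; case: (odd j) => /=.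
  rewrite add1n; have := sce_kappa_odd h.+1; rewrite doubleS => ->.
  rewrite sce_kappa_odd; have := sce_kappa_shift h.+1.
  by rewrite !doubleS -!natr1 nE => H; apply: (etrans _ (etrans H _)); ring.
rewrite add0n sce_kappa_odd.
have := sce_kappa_shift h; rewrite -!natr1 nE => H.
by apply: (addIr (- sce_kappa m h.*2.+2)); apply: (etrans _ (etrans H _)); ring.
Qed.

Lemma sce_kappa1 : n%:R * sce_kappa m 1 = sce_kappa m 0.
Proof.
have nE : n%:R = m.*2%:R + 1 :> R by rewrite {1}odd_dimE -natr1.
rewrite (sce_kappa_odd 0); have := sce_kappa_shift 0; rewrite nE mul1r => <-.
by rewrite addrC.
Qed.

(** The recursion has order two, hence the induction on consecutive pairs. The factor
    [sce_kappa m 0] will turn out to be gamma_n. *)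
Lemma sce_kappa_appell_alt j : sce_kappa m j = sce_kappa m 0 * appell_alt (n := n) j.
Proof.
have n0 : (0 < n)%N by rewrite odd_gt0.
suff : sce_kappa m j = sce_kappa m 0 * appell_alt (n := n) j /\
       sce_kappa m j.+1 = sce_kappa m 0 * appell_alt (n := n) j.+1 by case.
elim: j => [|j [IH IH1]].
  rewrite appell_alt0 // mulr1; split=> //.
  have n0' : n%:R != 0 :> R by rewrite pnatr_eq0 -lt0n.
  by apply: (mulfI n0'); rewrite sce_kappa1 mulrCA appell_alt1 // mulr1.
split=> //; have nj : n%:R + j.+1%:R != 0 :> R by rewrite -natrD addnS pnatr_eq0.
apply: (mulfI nj); rewrite sce_kappaSS IH IH1 [RHS]mulrCA appell_altS //; ring.
Qed.

Lemma fueter_sce k beta : iter_laplacian m (fun x => monomial k x * beta) =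
  fun x => if (m.*2 <= k)%N then
    appell (k - m.*2) x *
      ((sce_kappa m 0 * k`!%:R / (k - m.*2)`!%:R) *: beta)
  else 0.
Proof.
under eq_fun do rewrite monomial_axial.
rewrite iter_laplacian_axial_sum; apply/funext => x; case: ifP => // _.
rewrite appell_axial ?odd_gt0 // /axial_sum; apply: eq_bigr => j _.
rewrite sce_kappa_appell_alt /axial -!scalerAr !scalerA; congr (_ *: _).
by field; rewrite !natr_fact_neq0.
Qed.

End FueterSce.

(** * The constant gamma_n *)

Section SceConstant.
Context {R : realType}.

(* - gamma_poly k * exp(- t) is an antiderivative of t ^ k * exp(- t). *)
Fixpoint gamma_poly (k : nat) : {poly R} :=
  if k is k'.+1 then 'X^k + k%:R *: gamma_poly k' else 1.

Lemma gamma_polyB_deriv k : gamma_poly k - (gamma_poly k)^`() = 'X^k.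
Proof.
have dS j : (gamma_poly j.+1)^`() = j.+1%:R *: gamma_poly j.
  elim: j => [|j IH].
    by rewrite /= derivD derivZ derivXn expr0 -polyC1 derivC scaler0 addr0 scale1r.
  rewrite [gamma_poly j.+2]/= derivD derivZ IH derivXn /= -/(gamma_poly j.+1).
  by rewrite -scaler_nat -scalerDr.
case: k => [|k]; first by rewrite /= -polyC1 derivC subr0.
by rewrite dS /= addrK.
Qed.

Lemma gamma_poly0 k : (gamma_poly k).[0] = k`!%:R.
Proof.
elim: k => [|k IH]; first by rewrite hornerC.
by rewrite /= hornerD hornerXn expr0n /= add0r hornerZ IH factS natrM.
Qed.

(** The bound t^(k+1) / (k+1)! <= e^t gives t^k e^(-t) <= (k+1)! / t. *)
Lemma cvg_expn_expRN (k : nat) : (fun t : R => t ^+ k * expR (- t)) @ +oo%R --> (0 : R).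
Proof.
have hi : (fun t : R => k.+1`!%:R * t^-1) @ +oo%R --> (0 : R).
  rewrite -[X in _ --> X](mulr0 k.+1`!%:R); apply: cvgMr.
  by apply/gtr0_cvgV0; [exact: nbhs_pinfty_gt|exact: cvg_id].
apply: (squeeze_cvgr _ (cvg_cst 0) hi).
near=> t; have t0 : 0 < t by near: t; exact: nbhs_pinfty_gt.
rewrite mulr_ge0 ?exprn_ge0 ?expR_ge0 ?(ltW t0) //= expRN.
rewrite ler_pdivrMr ?expR_gt0 // mulrAC ler_pdivlMr // -exprSr mulrC.
rewrite -ler_pdivrMr ?ltr0n ?fact_gt0 //.
by apply: le_trans (expR_ge1Dxn k (ltW t0)); rewrite lerDr.
Unshelve. all: by end_near. Qed.

Lemma cvg_gamma_poly_expRN k :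
  (fun t : R => (gamma_poly k).[t] * expR (- t)) @ +oo%R --> (0 : R).
Proof.
elim: k => [|k IH].
  have := cvg_expn_expRN 0; apply: cvg_trans; apply: near_eq_cvg; near=> t.
  by rewrite expr0 hornerC.
have H := cvgD (cvg_expn_expRN k.+1) (cvgM (cvg_cst (k.+1%:R : R)) IH).
rewrite mulr0 addr0 in H.
suff -> : (fun t : R => (gamma_poly k.+1).[t] * expR (- t)) =
  (fun t : R => t ^+ k.+1 * expR (- t)) +
  (cst k.+1%:R * (fun t : R => (gamma_poly k).[t] * expR (- t))) by exact: H.
by apply/funext => t; rewrite /= hornerD hornerXn hornerZ mulrDl -mulrA.
Unshelve. all: by end_near. Qed.

Lemma is_derive_gamma_primitive k (t : R) :
  is_derive t 1 (fun s : R => - ((gamma_poly k).[s] * expR (- s)))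
    (t ^+ k * expR (- t)).
Proof.
have hE : is_derive t (1 : R) (fun s : R => expR (- s)) (- expR (- t)).
  have h := is_derive1_comp (is_derive_expR (- t)) (is_deriveNid t 1).
  by apply: (is_derive_ext h) => //; rewrite mulrN1.
have h := is_deriveN (is_deriveM (is_derive_poly (gamma_poly k) t) hE).
apply: (is_derive_ext h) => //.
have := congr1 (fun P : {poly R} => P.[t]) (gamma_polyB_deriv k).
rewrite hornerD hornerN hornerXn => <-.
rewrite mulrBl opprD; congr (_ + _); first by rewrite scalerN opprK.
by rewrite [in RHS]mulrC.
Qed.

(** For odd n the argument (n+1)/2 is an integer, where the integrand has an explicit primitive. *)
Lemma Gamma_nat (k : nat) : Gamma k.+1%:R = k`!%:R :> R.
Proof.
pose f (t : R) := t ^+ k * expR (- t).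
have cf : continuous f.
  move=> t; apply: cvgM; first exact: exprn_continuous.
  by apply: continuous_comp; [exact: opp_continuous|exact: continuous_expR].
have mf (D : set R) : measurable D -> measurable_fun D f.
  by move=> mD; apply: measurable_funTS; exact: continuous_measurable_fun.
transitivity (Rintegral lebesgue_measure `]0, +oo[%classic f).
  apply: eq_Rintegral => t; rewrite inE /= in_itv /= andbT => t0.
  by rewrite -natr1 addrK powR_mulrn // ltW.
rewrite /Rintegral integral_itv_obnd_cbnd; last by apply/measurable_EFinP; exact: mf.
pose F (t : R) := - ((gamma_poly k).[t] * expR (- t)).
have dF (t : R) : is_derive t 1 F (f t) := is_derive_gamma_primitive k t.
rewrite (@ge0_continuous_FTC2y _ f F 0 0).
- by rewrite /F gamma_poly0 oppr0 expR0 mulr1 sub0e /= opprK.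
- by move=> t t0; rewrite mulr_ge0 ?exprn_ge0 ?expR_ge0.
- exact: continuous_subspaceT.
- rewrite -oppr0; apply: cvgN; exact: cvg_gamma_poly_expRN.
- by move=> t _; have [] := dF t.
- apply: cvg_at_right_filter.
  have [dF0 _] := dF 0.
  exact/differentiable_continuous/derivable1_diffP.
- by move=> t _; rewrite derive1E; have := dF t => ?; rewrite derive_val.
Qed.

End SceConstant.

(** The numerator of kappa_m(0) is (-1)^m 2^m m!, and its denominator 1 3 ... (2m-1) is (2m)! / (2^m
    m!); with Gamma(m+1) = m! the quotient is gamma_n. *)
Lemma sce_constE (R : realType) (n : nat) : odd n ->
  sce_const n = sce_kappa (n := n) n.-1./2 0 :> R.
Proof.
move=> n_odd; set m := n.-1./2; have nE : n = m.*2.+1 by exact: odd_dimE.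
rewrite /sce_const; have -> : (n%:R + 1) / 2 = m.+1%:R :> R.
  by rewrite nE natr1 -doubleS -muln2 natrM mulfK // pnatr_eq0.
rewrite Gamma_nat sce_kappaE -/m.
have num k : \prod_(l < k) (l.*2%:R - (k.*2.+1%:R - 1)) =
    (-1) ^+ k * 2 ^+ k * k`!%:R :> R.
  elim: k => [|k IH]; first by rewrite big_ord0 !expr0 !mul1r.
  rewrite big_ord_recl factS natrM !exprS.
  transitivity ((- (2 * k.+1%:R)) * ((-1) ^+ k * 2 ^+ k * k`!%:R : R)); last by ring.
  rewrite -IH; congr (_ * _).
    by rewrite -natr1 addrK sub0r -muln2 natrM mulrC.
  apply: eq_bigr => l _; rewrite /bump /= !doubleS -!natr1; ring.
have den k : odd_prod k 0 * 2 ^+ k * k`!%:R = (k.*2)`!%:R :> R.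
  elim: k => [|k IH]; first by rewrite /odd_prod big_ord0 expr0 !mul1r.
  have dbl : k.*2%:R = 2 * k%:R :> R by rewrite -muln2 natrM mulrC.
  rewrite odd_prodS doubleS !factS !natrM -IH exprS -[k.*2.+2%:R]natr1.
  by rewrite -[k.*2.+1%:R]natr1 -[k.+1%:R]natr1 dbl double0; ring.
have -> : \prod_(l < m) (l.*2%:R - (n%:R - 1)) =
    (-1) ^+ m * 2 ^+ m * m`!%:R :> R.
  by rewrite -num -nE.
have -> : n.-1 = m.*2 by rewrite {1}nE.
rewrite -den /= -muln2 exprM.
have q0 := odd_prod_neq0 (R := R) m 0.
have f0 := natr_fact_neq0 (R := R) m.
have t0 : 2 ^+ m != 0 :> R by rewrite expf_neq0 // pnatr_eq0.
have -> : (2 ^+ m) ^+ 2 = 2 ^+ m * 2 ^+ m :> R by rewrite expr2.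
by rewrite /uphalf /=; field; rewrite t0 f0 q0.
Qed.

(** * Weighted power series *)

Section SeriesTools.
Context {R : realType}.

Lemma cvg_series_shift (u : nat -> R) N l :
  series (fun k => u (k + N)%N) @ \oo --> l <->
  series u @ \oo --> l + series u N.
Proof.
have E : series (fun k => u (k + N)%N) = fun M => series u (M + N)%N - series u N.
  apply/funext => M; rewrite /series /= (@big_cat_nat _ _ _ N 0 (M + N)) ?leq_addl //=.
  by rewrite [RHS]addrC addKr -[X in _ = \sum_(X <= _ < _) _]add0n big_addn addnK.
have -> : series u @ \oo --> l + series u N <->
    (fun M => series u (M + N)%N) @ \oo --> l + series u N.
  by rewrite (cvg_shiftn N).
rewrite E; split=> h.
  have -> : (fun M => series u (M + N)%N) =
      (fun M => series u (M + N)%N - series u N) + cst (series u N).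
    by apply/funext => M; rewrite !fctE subrK.
  exact: cvgD h (cvg_cst _).
have := cvgB h (cvg_cst (series u N)); rewrite addrK; exact.
Qed.

Lemma cvgn_series_shift (u : nat -> R) N :
  cvgn (series (fun k => u (k + N)%N)) <-> cvgn (series u).
Proof.
split=> /cvg_ex[l hl]; apply/cvg_ex.
  by exists (l + series u N); apply/cvg_series_shift.
by exists (l - series u N); apply/cvg_series_shift; rewrite subrK.
Qed.

(** From (a_k - d_k b_k)^2 >= 0. With a_k = |x|^k, the condition defining [Omega d] is the one that
    pairs with weighted square summability of coefficients. *)
Lemma summable_mul (d a b : nat -> R) : (forall k, 0 < d k) ->
  (forall k, 0 <= a k) -> (forall k, 0 <= b k) ->
  cvgn (series (fun k => a k ^+ 2 / d k)) ->
  cvgn (series (fun k => d k * b k ^+ 2)) ->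
  cvgn (series (fun k => a k * b k)).
Proof.
move=> d0 a0 b0 ca cb.
apply: (@series_le_cvg _ _ (fun k => a k ^+ 2 / d k + d k * b k ^+ 2)) => [k|k|k|].
- by rewrite mulr_ge0.
- by rewrite addr_ge0 ?mulr_ge0 ?sqr_ge0 ?invr_ge0 // ltW.
- have dk := d0 k; rewrite -(ler_pM2r dk) mulrDl divfK ?gt_eqF //.
  have := sqr_ge0 (a k - d k * b k).
  by have := mulr_ge0 (mulr_ge0 (a0 k) (b0 k)) (ltW dk); nra.
- exact: is_cvg_seriesD.
Qed.

Lemma pseries_diffs_summable (a : nat -> R) (delta : R) :
  (forall r : R, 0 <= r -> r < delta -> cvgn (series (fun k => `|a k| * r ^+ k))) ->
  forall r : R, 0 <= r -> r < delta ->
    cvgn (series (fun k => `|pseries_diffs a k| * r ^+ k)).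
Proof.
move=> ca; have J_open (r : R) : r < delta -> exists2 s, r < s & s < delta.
  by move=> rd; exists ((r + delta) / 2); rewrite (midf_lt rd).
move=> r r0 rd.
have H := summable_deriv (J := fun r => r < delta) J_open (e := id)
  (fun k => normr_ge0 (a k)) ca r0 rd.
apply: cvgn_series_eq ((cvgn_series_shift _ 1).2 H) => k.
by rewrite addn1 /= /pseries_diffs normrM ger0_norm.
Qed.

(** Induction on k for all a and F at once: F' is the sum of the series of [pseries_diffs a] on the
    same interval. Absolute convergence is carried along because [pseries_snd_diffs] needs the
    series and two formal derivatives at a larger radius. *)
Lemma derive1n_pseries (a : nat -> R) (F : R -> R) (delta : R) k : 0 < delta ->
  (forall t : R, `|t| < delta -> series (fun k => a k * t ^+ k) @ \oo --> F t) ->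
  derive1n k F 0 = k`!%:R * a k.
Proof.
move=> delta0 aF.
have ca (r : R) : 0 <= r -> r < delta -> cvgn (series (fun k => `|a k| * r ^+ k)).
  move=> r0 rd; set s := (r + delta) / 2.
  have rs : r < s by rewrite /s (midf_lt rd).
  have sd : s < delta by rewrite /s (midf_lt rd).
  have s0 : 0 <= s by rewrite (le_trans r0) // ltW.
  apply: (@is_cvg_pseries_inside_norm _ a s); last by rewrite !ger0_norm.
  by apply: cvgP; apply: aF; rewrite ger0_norm.
elim: k a F aF ca => [|k IH] a F aF ca.
  rewrite derive1n0 mul1r.
  have F0 : series (fun k => a k * 0 ^+ k) @ \oo --> F 0 by apply: aF; rewrite normr0.
  have a0 : series (fun k => a k * 0 ^+ k) @ \oo --> 0 + series (fun k => a k * 0 ^+ k) 1.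
    apply/cvg_series_shift.
    have -> : series (fun k => a (k + 1)%N * 0 ^+ (k + 1)) = cst 0.
      by apply/funext => N; rewrite /series /= big1 // => j _; rewrite addn1 expr0n mulr0.
    exact: cvg_cst.
  rewrite -(cvg_lim _ F0) // (cvg_lim _ a0) // add0r /series /= big_nat1.
  by rewrite expr0 mulr1.
have cda := pseries_diffs_summable ca.
have cdda := pseries_diffs_summable cda.
have abs (b : nat -> R) (r : R) : cvgn (series (fun k => `|b k| * r ^+ k)) ->
    0 <= r -> cvgn (pseries b r).
  move=> cb r0; apply: normed_cvg; apply: cvgn_series_eq cb => j.
  by rewrite /= [RHS]normrM (ger0_norm (exprn_ge0 _ _)).
have dF (t : R) : `|t| < delta ->
    is_derive t 1 F (limn (pseries (pseries_diffs a) t)).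
  move=> td; set s := (`|t| + delta) / 2.
  have ts : `|t| < s by rewrite /s (midf_lt td).
  have sd : s < delta by rewrite /s (midf_lt td).
  have s0 : 0 <= s by rewrite (le_trans _ (ltW ts)).
  have : is_derive t 1 (fun x => limn (pseries a x)) (limn (pseries (pseries_diffs a) t)).
    apply: (@pseries_snd_diffs _ _ s); rewrite ?(ger0_norm s0) //.
    - by apply: abs => //; exact: ca.
    - by apply: abs => //; exact: cda.
    - by apply: abs => //; exact: cdda.
  apply: near_eq_is_derive.
  have : \forall y \near t, `|y| < delta.
    exact: (cvgr_lt _ (@norm_continuous R R t)) td.
  by apply: filterS => y yd; apply: cvg_lim => //; exact: aF.
rewrite derive1Sn (IH (pseries_diffs a)) => [|t td|].
- by rewrite /pseries_diffs factS natrM mulrA [_ * k`!%:R]mulrC.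
- rewrite derive1E; have := dF t td => ?; rewrite derive_val.
  have : cvgn (series (fun k => `|pseries_diffs a k| * `|t| ^+ k)) by exact: cda.
  move=> ct; apply: normed_cvg; apply: cvgn_series_eq ct => j.
  by rewrite /= [RHS]normrM normrX.
- exact: cda.
Qed.

End SeriesTools.

(** * Domains of convergence and weights *)

Section Domains.
Context {R : realType}.

(* The radii below the radius of convergence; Omega d may also contain the
   points of norm equal to it. *)
Definition inner_radius (d : nat -> R) (r : R) : Prop :=
  exists2 s, r < s & cvgn (series (fun k => s ^+ (2 * k) / d k)).

Lemma inner_radius_down d r s : 0 <= r -> r <= s -> inner_radius d s -> inner_radius d r.
Proof. by move=> _ rs [t st ct]; exists t => //; exact: le_lt_trans st. Qed.

Lemma inner_radius_open d r : inner_radius d r ->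
  exists2 s, r < s & inner_radius d s.
Proof.
by move=> [t rt ct]; exists ((r + t) / 2); [|exists t => //]; rewrite (midf_lt rt).
Qed.

Lemma radius_le d (r s : R) : (forall k, 0 < d k) -> 0 <= r -> r <= s ->
  cvgn (series (fun k => s ^+ (2 * k) / d k)) ->
  cvgn (series (fun k => r ^+ (2 * k) / d k)).
Proof.
move=> d0 r0 rs; have s0 := le_trans r0 rs; apply: series_le_cvg => k.
- by rewrite divr_ge0 ?exprn_ge0 // ltW.
- by rewrite divr_ge0 ?exprn_ge0 // ltW.
- by rewrite ler_wpM2r ?invr_ge0 ?(ltW (d0 k)) // lerXn2r.
Qed.

Lemma inner_radius_Omega n d (x : 'rV[R]_n.+1) : (forall k, 0 < d k) ->
  inner_radius d (enorm x) -> Omega n d x.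
Proof.
by move=> d0 [s xs]; apply: radius_le => //; [exact: enorm_ge0|exact: ltW].
Qed.

(** An interior point can be pushed outwards within [Omega], which yields a strictly larger radius
    of convergence; the direction w is x itself, or a unit vector if x = 0. *)
Lemma interior_Omega n d : (forall k, 0 < d k) ->
  (Omega n d)° = [set x | inner_radius d (enorm x)].
Proof.
move=> d0; apply/seteqP; split=> x /=; last first.
  move=> Jx; rewrite /interior.
  have := near_radius (@inner_radius_down d) (@inner_radius_open d) Jx.
  by apply: filterS => y; exact: inner_radius_Omega.
move=> ix.
have [w w0 wE] : exists2 w : 'rV[R]_n.+1, 0 < enorm w &
    forall t : R, 0 <= t -> enorm (t *: w + x) = t * enorm w + enorm x.
  have [->|x0] := eqVneq x 0.
    exists (delta_mx 0 ord0); first by rewrite enorm_delta.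
    move=> t t0; rewrite addr0 enormZ ger0_norm //.
    by rewrite -(scale0r 0) enormZ normr0 mul0r addr0.
  exists x.
    by rewrite lt_neqAle enorm_ge0 andbT eq_sym (contra_neq _ x0) //; exact: enorm_eq0.
  move=> t t0; rewrite -[X in _ + X]scale1r -scalerDl enormZ ger0_norm ?addr_ge0 //.
  by rewrite mulrDl mul1r.
have cw : (fun t : R => t *: w + x) @ (0 : R) --> x.
  have {2}<- : (0 : R) *: w + x = x by rewrite scale0r add0r.
  by apply: cvgD; [apply: cvgZl; exact: cvg_id|exact: cvg_cst].
have /nbhs_ballP[e /= e0 he] := cw _ ix.
have := he (e / 2); rewrite /ball /= sub0r normrN gtr0_norm ?divr_gt0 //.
rewrite ltr_pdivrMr // ltr_pMr // ltr1n => /(_ isT).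
rewrite /Omega /= wE ?divr_ge0 ?(ltW e0) // => h.
by exists (e / 2 * enorm w + enorm x) => //; rewrite ltrDr mulr_gt0 // divr_gt0.
Qed.

End Domains.

Section Weights.
Context {R : realType} {n : nat}.
Variable c : nat -> R.
Hypothesis n_gt0 : (0 < n)%N.
Hypothesis c_nd : nondecreasing_seq c.
Hypothesis c0 : c 0%N = 1.
Notation b := (sce_weight n c).

Lemma c_ge1 k : 1 <= c k.
Proof. by rewrite -c0 c_nd. Qed.

Lemma c_gt0 k : 0 < c k.
Proof. exact: lt_le_trans (c_ge1 k). Qed.

Lemma sce_weightE k : b k = c (k + n.-1)%N * (k`!%:R / (k + n.-1)`!%:R) ^+ 2.
Proof.
rewrite /sce_weight -mulrA -expr_div_n; congr (c _ * (_ / _`!%:R) ^+ 2).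
  by rewrite -subn1 -addnBA // subn1.
by rewrite addnC -subn1 -addnBA // subn1.
Qed.

Lemma sce_weight_gt0 k : 0 < b k.
Proof.
by rewrite sce_weightE mulr_gt0 ?c_gt0 // exprn_gt0 // divr_gt0 ?ltr0n ?fact_gt0.
Qed.

(** As c_k >= 1, a geometric series is a majorant. *)
Lemma inner_radius_c r : 0 <= r -> r < 1 -> inner_radius c r.
Proof.
move=> r0 r1; exists ((r + 1) / 2); first by rewrite (midf_lt r1).
have s1 : (r + 1) / 2 < 1 by rewrite (midf_lt r1).
set s := _ / 2 in s1 *; have s0 : 0 <= s by rewrite /s divr_ge0 ?addr_ge0.
apply: (@series_le_cvg _ _ (geometric 1 (s ^+ 2))) => [k|k|k|].
- by rewrite divr_ge0 ?exprn_ge0 // ltW ?c_gt0.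
- by rewrite /= mul1r !exprn_ge0.
- rewrite /= mul1r -exprM ler_pdivrMr ?c_gt0 // ler_peMr ?exprn_ge0 ?c_ge1 //.
- by apply: is_cvg_geometric_series; rewrite ger0_norm ?exprn_ge0 // exprn_ilt1.
Qed.

(** From c to b a polynomial factor has to be absorbed by shrinking s to t; from b to c the same s
    works, because b_k <= c_(k+n-1). *)
Lemma inner_radius_weight r : 0 <= r -> inner_radius c r <-> inner_radius b r.
Proof.
move=> r0; split=> -[s rs cs]; have s0 := le_trans r0 (ltW rs).
  have [rt ts] : r < (r + s) / 2 /\ (r + s) / 2 < s by rewrite !(midf_lt rs).
  set t := _ / 2 in rt ts; have t0 := le_trans r0 (ltW rt).
  have d0 : 0 < s - t by rewrite subr_gt0.
  (* Chosen so that t^k (k+n-1)! / k! <= M s^(k+n-1), by [binomial_term_le]. *)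
  pose M := n.-1`!%:R / (s - t) ^+ n.-1.
  exists t => //; apply: (@series_le_cvg _ _
      (fun k => M ^+ 2 * (s ^+ (2 * (k + n.-1)) / c (k + n.-1)%N))) => [k|k|k|].
  - by rewrite divr_ge0 ?exprn_ge0 // ltW ?sce_weight_gt0.
  - by rewrite mulr_ge0 ?sqr_ge0 // divr_ge0 ?exprn_ge0 // ltW ?c_gt0.
  - have B := binomial_term_le k n.-1 t0 (ltW ts).
    have F : (k + n.-1)`!%:R = 'C(k + n.-1, n.-1)%:R * (n.-1`!%:R * k`!%:R) :> R.
      by rewrite -!natrM -{3}(addnK n.-1 k) bin_fact // leq_addl.
    have f0 := natr_fact_neq0 (R := R).
    rewrite sce_weightE.
    have -> : t ^+ (2 * k) / (c (k + n.-1)%N * (k`!%:R / (k + n.-1)`!%:R) ^+ 2) =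
        (t ^+ k * (k + n.-1)`!%:R / k`!%:R) ^+ 2 / c (k + n.-1)%N.
      rewrite mulnC exprM invfM mulrCA mulrC -exprVn invf_div -exprMn.
      by rewrite mulrA.
    rewrite mulrA ler_wpM2r ?invr_ge0 ?(ltW (c_gt0 _)) //.
    rewrite [(2 * _)%N]mulnC exprM -exprMn lerXn2r ?nnegrE //.
    + by rewrite !mulr_ge0 ?exprn_ge0 ?invr_ge0.
    + by rewrite !mulr_ge0 ?exprn_ge0 ?invr_ge0 // ?exprn_ge0 // ltW.
    rewrite F /M [leRHS]mulrAC ler_pdivlMr ?exprn_gt0 //.
    rewrite [leLHS](_ : _ = n.-1`!%:R *
      ('C(k + n.-1, n.-1)%:R * t ^+ k * (s - t) ^+ n.-1)); last by field; exact: f0.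
    by rewrite ler_wpM2l.
  - have := is_cvg_seriesZ (k := M ^+ 2) ((cvgn_series_shift _ n.-1).2 cs).
    exact: cvgn_series_eq.
exists s => //; apply/(cvgn_series_shift _ n.-1).
have cs' : cvgn (series (fun k => s ^+ (2 * k) / c (k + n.-1)%N)).
  apply: series_le_cvg cs => k.
  - by rewrite divr_ge0 ?exprn_ge0 // ltW ?c_gt0.
  - by rewrite divr_ge0 ?exprn_ge0 // ltW ?sce_weight_gt0.
  - rewrite ler_wpM2l ?exprn_ge0 // lef_pV2 ?posrE ?c_gt0 ?sce_weight_gt0 //.
    rewrite sce_weightE ler_piMr ?(ltW (c_gt0 _)) // exprn_ile1 ?divr_ge0 //.
    by rewrite ler_pdivrMr ?ltr0n ?fact_gt0 // mul1r ler_nat leq_fact // leq_addr.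
apply: cvgn_series_eq (is_cvg_seriesZ (k := s ^+ (2 * n.-1)) cs') => k.
by rewrite mulnDr exprD [RHS]mulrAC [RHS]mulrC.
Qed.

End Weights.

(** * Clifford-Appell polynomials on the real axis and their norm *)

Section AppellBounds.
Context {R : realType} {n : nat}.
Hypothesis n_gt0 : (0 < n)%N.
Notation e0 := (delta_mx 0 ord0 : 'rV[R]_n.+1).

Lemma vec_part_real (t : R) : vec_part (t *: e0) = 0 :> clifford R n.
Proof. by apply: big1 => l _; rewrite !mxE /= mulr0 scale0r. Qed.

Lemma paravec_real (t : R) : paravec (t *: e0) = t%:A :> clifford R n.
Proof. by rewrite /paravec vec_part_real addr0 !mxE eqxx mulr1. Qed.

Lemma paravec_conj_real (t : R) : paravec_conj (t *: e0) = t%:A :> clifford R n.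
Proof. by rewrite /paravec_conj vec_part_real subr0 !mxE eqxx mulr1. Qed.

Lemma monomial_real k (t : R) : monomial k (t *: e0) = (t ^+ k)%:A :> clifford R n.
Proof. by rewrite /monomial paravec_real exprZn expr1n. Qed.

Lemma appell_real k (t : R) : appell k (t *: e0) = (t ^+ k)%:A :> clifford R n.
Proof.
rewrite -[LHS]mulr1 appell_axial // /axial_sum big_ord_recl big1 => [|j _].
  rewrite appell_alt0 // subn0 /axial expr0 mul1r fact0 mulr1 !mxE eqxx mulr1.
  by rewrite scalerA mul1r scalerA mulrAC mulVf ?mul1r ?addr0 // natr_fact_neq0.
by rewrite /axial vec_part_real exprS !mul0r !scaler0.
Qed.

Lemma appell_coef_ge0 k s : 0 <= appell_coef n k s :> R.
Proof.
have poch_ge0 (a : R) i : 0 <= a -> 0 <= poch a i.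
  by move=> a0; apply: prodr_ge0 => j _; rewrite addr_ge0.
have p0 : 0 <= (n%:R + 1) / 2 :> R by rewrite divr_ge0 ?addr_ge0.
have q0 : 0 <= (n%:R - 1) / 2 :> R by rewrite divr_ge0 ?subr_ge0 ?ler1n.
by rewrite /appell_coef mulr_ge0 // divr_ge0 ?mulr_ge0 ?poch_ge0.
Qed.

(** Read off from P_k(1) = 1, in place of a Chu-Vandermonde summation. *)
Lemma sum_appell_coef k : \sum_(s < k.+1) appell_coef n k s = 1 :> R.
Proof.
have : appell k (1 *: e0) = (\sum_(s < k.+1) appell_coef n k s)%:A :> clifford R n.
  rewrite /appell scaler_suml; apply: eq_bigr => s _.
  by rewrite paravec_real paravec_conj_real !scale1r !expr1n mulr1.
rewrite appell_real expr1n => /(congr1 (fun a : clifford R n => a finset.set0)).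
by rewrite !ffunE eqxx !mulr1.
Qed.

(** P_k(x) is a convex combination of products of k factors x or its conjugate, each of which
    multiplies norms by |x|. *)
Lemma appell_bound k (x : 'rV[R]_n.+1) a :
  cl_norm (appell k x * a) <= enorm x ^+ k * cl_norm a.
Proof.
rewrite /appell mulr_suml (le_trans (cl_norm_sum _ _ _)) //.
rewrite -[leRHS]mul1r -(sum_appell_coef k) mulr_suml; apply: ler_sum => s _.
have sk : (s <= k)%N by rewrite -ltnS.
rewrite -scalerAl cl_normZ ger0_norm ?appell_coef_ge0 //.
rewrite -[_ ^+ _ * _ * a]mulrA cl_norm_paravecXMl cl_norm_paravec_conjXMl.
by rewrite [enorm x ^+ _ * _]mulrA -exprD subnK.
Qed.

End AppellBounds.

(** * Expansions, their coefficients and the norm identity *)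

Section Expansions.
Context {R : realType} {n : nat}.
Notation point := 'rV[R]_n.+1.
Notation e0 := (delta_mx 0 ord0 : point).
Implicit Types (phi : nat -> point -> clifford R n) (f : point -> clifford R n)
  (alpha : nat -> clifford R n).

Lemma enorm_real (t : R) : enorm (t *: e0) = `|t|.
Proof. by rewrite enormZ enorm_delta mulr1. Qed.

(** The witness is the very family picked by [xget] in [wnorm]; the square root is undone because
    the limit is nonnegative. *)
Lemma wspace_norm phi d f : (forall k, 0 <= d k) -> wspace phi d f ->
  exists2 alpha, expansion phi d f alpha &
    wnorm phi d f ^+ 2 = limn (series (fun k => d k * cl_norm (alpha k) ^+ 2)).
Proof.
move=> d0 [al hal].
exists (xget (fun=> 0) [set alpha | expansion phi d f alpha]).
  exact: (xgetPex _ (ex_intro _ al hal)).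
rewrite /wnorm sqr_sqrtr //; set beta := xget _ _.
have [cb _] : expansion phi d f beta by exact: (xgetPex _ (ex_intro _ al hal)).
apply: le_trans (series_le_lim 0 _ cb); first by rewrite /series /= big_nil.
by move=> k; rewrite mulr_ge0 ?sqr_ge0.
Qed.

Lemma coef_real_axis phi alpha f :
  (forall k (t : R), phi k (t *: e0) = (t ^+ k)%:A) ->
  (forall t : R, `|t| < 1 ->
     cl_sums_to (fun k => phi k (t *: e0) * alpha k) (f (t *: e0))) ->
  forall k, real_derivn0 k f = k`!%:R *: alpha k.
Proof.
move=> phiE falpha k; apply/ffunP => A; rewrite !ffunE.
apply: (derive1n_pseries (a := fun k => alpha k A) _ (ltr01)) => t t1.
have E : (fun j => (phi j (t *: e0) * alpha j) A) = fun j => alpha j A * t ^+ j.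
  by apply/funext => j; rewrite phiE mulr_algl ffunE mulrC.
by have := falpha t t1 A; rewrite E.
Qed.

Lemma monomial_growth k beta :
  growth k (cl_norm beta) (fun x : point => monomial k x * beta).
Proof.
elim: k => [|k IH].
  have := growth_cst beta; congr growth.
  by apply/funext => x; rewrite /monomial expr0 mul1r.
have := growth_paravecMl IH; congr growth.
by apply/funext => x; rewrite /monomial exprS mulrA.
Qed.

Lemma monomial_dominated d beta : (forall k, 0 < d k) ->
  cvgn (series (fun k => d k * cl_norm (beta k) ^+ 2)) ->
  dominated (inner_radius d) (fun k (x : point) => monomial k x * beta k).
Proof.
move=> d0 cb; exists id, (fun k => cl_norm (beta k)); split.
  by move=> k; exact: monomial_growth.
move=> r r0 [s rs cs].
have cr := radius_le d0 r0 (ltW rs) cs.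
have := @summable_mul _ d (fun k => r ^+ k) (fun k => cl_norm (beta k)) d0.
move=> /(_ (fun k => exprn_ge0 k r0) (fun k => cl_norm_ge0 _) _ cb) H.
apply: cvgn_series_eq (H _) => [k|]; first by rewrite mulrC.
by apply: cvgn_series_eq cr => k; rewrite mulnC exprM.
Qed.

End Expansions.

Section SceExpansion.
Context {R : realType} {n : nat}.
Hypothesis n_odd : odd n.
Variable c : nat -> R.
Hypothesis c_nd : nondecreasing_seq c.
Hypothesis c0 : c 0%N = 1.
Notation b := (sce_weight n c).
Notation m := n.-1./2.
Notation gamma := (sce_const n : R).
Implicit Types (f : 'rV[R]_n.+1 -> clifford R n) (beta : nat -> clifford R n).

Let n_gt0 : (0 < n)%N. Proof. exact: odd_gt0. Qed.
Let c_pos : forall k, 0 < c k := c_gt0 c_nd c0.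
Let b_pos : forall k, 0 < b k := sce_weight_gt0 n_gt0 c_nd c0.

Definition sce_coef beta (j : nat) : clifford R n :=
  (gamma * (j + n.-1)`!%:R / j`!%:R) *: beta (j + n.-1)%N.

Lemma sce_coef_weight beta j : b j * cl_norm (sce_coef beta j) ^+ 2 =
  gamma ^+ 2 * (c (j + n.-1)%N * cl_norm (beta (j + n.-1)%N) ^+ 2).
Proof.
rewrite /sce_coef cl_normZ [(`|_| * _) ^+ 2]exprMn real_normK ?num_real //.
rewrite (sce_weightE c n_gt0) //; field.
by rewrite !natr_fact_neq0.
Qed.

Lemma double_half_pred : m.*2 = n.-1.
Proof. by rewrite [in RHS](odd_dimE n_odd). Qed.

Lemma interior_sce : (Omega n c)° = (Omega n b)°.
Proof.
rewrite !interior_Omega //; apply/seteqP; split=> x /= Jx.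
  by apply/(inner_radius_weight n_gt0 c_nd c0) => //; exact: enorm_ge0.
by apply/(inner_radius_weight n_gt0 c_nd c0); [exact: enorm_ge0|].
Qed.

Lemma sce_expansion f beta : expansion (@monomial R n) c f beta ->
  iter_laplacian_exists m [set x | inner_radius c (enorm x)] f /\
  forall x, inner_radius c (enorm x) ->
    cl_sums_to (fun j => appell j x * sce_coef beta j) (iter_laplacian m f x).
Proof.
move=> [cb fb].
have [_ ex sums] := dominated_iter_laplacian (@inner_radius_down _ c)
  (@inner_radius_open _ c) m (monomial_dominated c_pos cb)
  (fun y Jy => fb y (inner_radius_Omega c_pos Jy)).
split=> // x Jx A; have := sums x Jx A; set L := iter_laplacian m f x A.
under [fun k => iter_laplacian _ _ _ A]eq_fun do rewrite fueter_sce // double_half_pred.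
set v := fun k => _ => vL.
(* The terms below n - 1 are annihilated, so the shift of index leaves the sum unchanged. *)
have vE : series v n.-1 = 0.
  rewrite /series /= big_nat big1 // => k /andP[_ kn].
  by rewrite /v leqNgt kn /= ffunE.
have {vL} : series v @ \oo --> L + series v n.-1 by rewrite vE addr0.
move=> /(cvg_series_shift _ _ _).2.
suff -> : (fun k => v (k + n.-1)%N) = (fun j => (appell j x * sce_coef beta j) A) by [].
by apply/funext => j; rewrite /v leq_addl addnK /sce_coef sce_constE.
Qed.

Lemma sce_coef_summable beta :
  cvgn (series (fun k => c k * cl_norm (beta k) ^+ 2)) ->
  cvgn (series (fun k => b k * cl_norm (sce_coef beta k) ^+ 2)).
Proof.
move=> /(cvgn_series_shift _ n.-1).2 cs.
apply: cvgn_series_eq (is_cvg_seriesZ (k := gamma ^+ 2) cs) => j.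
by rewrite sce_coef_weight.
Qed.

(** [Omega b] may contain boundary points, so an element of [HM] is built on all of it from the
    coefficients, not from the iterated Laplacian. *)
Lemma appell_series alpha :
  cvgn (series (fun k => b k * cl_norm (alpha k) ^+ 2)) ->
  exists h, expansion (@appell R n) b h alpha.
Proof.
move=> ca.
exists (fun x => [ffun A => limn (series (fun k => (appell k x * alpha k) A))]).
split=> // x Ox A; rewrite ffunE.
have cx : cvgn (series (fun k => enorm x ^+ k * cl_norm (alpha k))).
  apply: (@summable_mul _ b (fun k => enorm x ^+ k) (fun k => cl_norm (alpha k)))
    => // [k|k|].
  - by rewrite exprn_ge0 ?enorm_ge0.
  - exact: cl_norm_ge0.
  - by apply: cvgn_series_eq Ox => k; rewrite mulnC exprM.
apply: cvgn_series_dominated cx => k.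
exact: le_trans (cl_norm_comp _ _) (appell_bound n_gt0 k x _).
Qed.

Lemma cl_sums_to_unique (u : nat -> clifford R n) a a' :
  cl_sums_to u a -> cl_sums_to u a' -> a = a'.
Proof.
move=> ha ha'; apply/ffunP => A.
by rewrite -(cvg_lim _ (ha A)) // (cvg_lim _ (ha' A)).
Qed.

(** On the real interval ]-1, 1[, inside the interior, both families sum to the same h and are given
    by its derivatives at 0. This pins down the coefficients picked by [HM_norm]. *)
Lemma sce_coef_unique f h beta alpha : expansion (@monomial R n) c f beta ->
  expansion (@appell R n) b h alpha ->
  eq_on (Omega n b)° (iter_laplacian m f) h -> alpha = sce_coef beta.
Proof.
move=> fb [_ ha]; rewrite -interior_sce interior_Omega // => fh.
have [_ fc] := sce_expansion fb.
have Jt (t : R) : `|t| < 1 -> inner_radius c (enorm (t *: delta_mx 0 ord0 : 'rV[R]_n.+1)).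
  by move=> t1; rewrite enorm_real; exact: inner_radius_c.
have ra : forall k, real_derivn0 k h = k`!%:R *: alpha k.
  apply: (coef_real_axis (appell_real n_gt0)) => t t1; apply: ha.
  apply: inner_radius_Omega => //.
  by apply/(inner_radius_weight n_gt0 c_nd c0); [exact: enorm_ge0|exact: Jt].
have rb : forall k, real_derivn0 k h = k`!%:R *: sce_coef beta k.
  apply: (coef_real_axis (appell_real n_gt0)) => t t1; rewrite -fh; last exact: Jt.
  exact: fc (Jt t t1).
apply/funext => k; have k0 := natr_fact_neq0 (R := R) k.
by apply: (scalerI k0); rewrite -ra -rb.
Qed.

End SceExpansion.

Theorem theorem4p3 (R : realType) (n : nat) (n_odd : odd n)
    (c : nat -> R) (c_nd : nondecreasing_seq c) (c0 : c 0%N = 1) :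
  let b := sce_weight n c in
  let m := n.-1./2 in
  [/\ (Omega n c)° = (Omega n b)°,
      forall f : 'rV[R]_n.+1 -> clifford R n, HS n c f ->
        iter_laplacian_exists m (Omega n c)° f,
      iter_laplacian m @` HS n c `<=` HM_interior n b
    & forall f h : 'rV[R]_n.+1 -> clifford R n,
        HS n c f -> HM n b h -> eq_on (Omega n b)° (iter_laplacian m f) h ->
        HM_norm n b h ^+ 2 =
        sce_const n ^+ 2 *
          (HS_norm n c f ^+ 2 -
           \sum_(k < n.-1)
              c k * cl_norm (real_derivn0 k f) ^+ 2 / k`!%:R ^+ 2)].
Proof.
move=> b m.
have n_gt0 : (0 < n)%N by exact: odd_gt0.
have c_pos k : 0 < c k := c_gt0 c_nd c0 k.
have b_pos k : 0 < b k := sce_weight_gt0 n_gt0 c_nd c0 k.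
have intE : (Omega n c)° = (Omega n b)° := interior_sce n_odd c_nd c0.
split; first exact: intE.
- move=> f [beta fb]; rewrite interior_Omega //.
  by have [] := sce_expansion n_odd c_nd c0 fb.
- move=> _ [f [beta fb] <-].
  have [_ fc] := sce_expansion n_odd c_nd c0 fb.
  have [h ha] := appell_series n_odd c_nd c0 (sce_coef_summable n_odd fb.1).
  exists h; first by exists (sce_coef beta).
  move=> x; rewrite -intE interior_Omega //= => Jx.
  apply: cl_sums_to_unique (fc x Jx) (ha.2 x _).
  apply: inner_radius_Omega => //.
  by apply/(inner_radius_weight n_gt0 c_nd c0); [exact: enorm_ge0|].
move=> f h Hf Hh fh.
have [beta fb nb] := wspace_norm (fun k => ltW (c_pos k)) Hf.
have [alpha ha na] := wspace_norm (fun k => ltW (b_pos k)) Hh.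
rewrite (sce_coef_unique n_odd c_nd c0 fb ha fh) in na.
apply: (etrans na); rewrite [HS_norm n c f ^+ 2]nb.
have fd k : real_derivn0 k f = k`!%:R *: beta k.
  apply: (coef_real_axis (@monomial_real R n)) => t t1; apply: fb.2.
  by apply: inner_radius_Omega => //; rewrite enorm_real; exact: inner_radius_c.
set u := fun k => c k * cl_norm (beta k) ^+ 2.
have -> : \sum_(k < n.-1) c k * cl_norm (real_derivn0 k f) ^+ 2 / k`!%:R ^+ 2 =
    series u n.-1.
  rewrite /series /= big_mkord; apply: eq_bigr => k _.
  rewrite fd cl_normZ [(_ * _) ^+ 2]exprMn real_normK ?num_real // /u.
  by field; exact: natr_fact_neq0.
apply: cvg_lim => //.
have -> : series (fun k => b k * cl_norm (sce_coef beta k) ^+ 2) =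
    fun N => sce_const n ^+ 2 * series (fun k => u (k + n.-1)%N) N.
  apply/funext => N; rewrite /series /= mulr_sumr; apply: eq_bigr => k _.
  by rewrite sce_coef_weight.
(* What remains is that the tail of [u] from n - 1 on sums to the full sum minus the first n - 1
   terms. *)
apply: cvgMr; apply/cvg_series_shift; rewrite subrK.
exact: fb.1.
Qed.
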